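(* Let $D=\lambda-x-y+x^{-1}y^{-1}\in A=\mathbf{k}\langle q^{\pm1},x^{\pm1},y^{\pm1}\rangle$ with $\lambda$ a parameter. Then for every integer $n\ge1$ $$\det(\rho_{n,\xi,\eta}(D))=-\xi^n-\eta^n+\xi^{-n}\eta^{-n}+F\big(G_q(\lambda)^n\big)\mod\Phi_n(q),$$ where $G_q(\lambda)$ and $F(u)$ are the infinite series defined by $$G_q(\lambda)=\lambda\exp\big(\mathrm{Coeff}_{0,0}(\log(\lambda^{-1}D))\big),\qquad F(G_1(\lambda))=\lambda .$$
   Context: $\mathbf{k}$ is a field of characteristic zero. $A=\mathbf{k}\langle q^{\pm1},x^{\pm1},y^{\pm1}\rangle$ is the algebra with $q$ central and $yx=qxy$; $\lambda$ is a central parameter and all series are formal power series in $\lambda^{-1}$ (Laurent, with finitely many positive powers of $\lambda$). $\Phi_n(q)$ is the $n$-th cyclotomic polynomial. For formal parameters $\xi,\eta$, $\rho_{n,\xi,\eta}$ is the $n$-dimensional representation of $A/\Phi_n(q)$ with basis $\{v_j:j\in\mathbb{Z}/(n)\}$: $xv_j=\xi v_{j+1}$, $yv_j=q^j\eta v_j$. $\exp$ and $\log$ are defined as infinite power series (with $\log(\lambda^{-1}D)$ expanded in powers of $\lambda^{-1}$), and $\mathrm{Coeff}_{i,j}$ is the coefficient at $x^iy^j$ of a Laurent series in $x,y$. $G_1(\lambda)$ is $G_q(\lambda)$ at $q=1$; it has leading term $\lambda$, and $F(u)$ is its compositional inverse, a series in $u^{-1}$ with leading term $u$. *)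

(* Defs.v *)
From HB Require Import structures.
From mathcomp Require Import all_boot all_order all_algebra all_field.
From mathcomp Require Import mathcomp_extra boolp classical_sets functions.
From mathcomp Require Import cardinality fsbigop ring.

Set Implicit Arguments.
Unset Strict Implicit.
Unset Printing Implicit Defensive.

Import Order.TTheory GRing.Theory Num.Theory.
Local Open Scope classical_set_scope.
Local Open Scope ring_scope.

(******************************************************************************)
(*   conv R S       == functions f : G -> R whose support lies in the ideal S *)
(*                     of subsets of the monoid G, with the convolution       *)
(*                     product; f x is the coefficient at x                   *)
(*   convU S g r    == the element r.g of conv R S                            *)
(*   lser R         == R((lambda^-1)): Laurent series in lambda^-1, with      *)
(*                     finitely many positive powers of lambda; f m is the    *)
(*                     coefficient at lambda^m (for the series F(u), at u^m)  *)
(*   laurent R      == R[q, q^-1]                                             *)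
(*   laurent2 R     == R[xi, xi^-1, eta, eta^-1]                              *)
(*   qtorus k       == A = k<q^+-1, x^+-1, y^+-1> with q central, y x = q x y *)
(* Every conv R S carries the unit ring structure in which the units are the  *)
(* two-sided invertible elements, so that division by m%:R, f^-1 and integer  *)
(* powers f ^ i have their usual meaning as soon as the inverses exist.       *)
(******************************************************************************)

Section FiberSum.
Variables (V : Type) (idx : V) (op : Monoid.com_law idx).

Lemma fsbig_fiber (I J : choiceType) (h : I -> J) (P : set I) (F : I -> V) :
  finite_set (P `&` F @^-1` [set~ idx]) ->
  \big[op/idx]_(i \in P) F i
  = \big[op/idx]_(j \in [set: J]) \big[op/idx]_(i \in P `&` h @^-1` [set j]) F i.
Proof.
move=> finA; set A := _ `&` _ in finA.
have finB : finite_set (h @` A) by exact: finite_image.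
have inner j : \big[op/idx]_(i \in P `&` h @^-1` [set j]) F i
             = \big[op/idx]_(i \in A) (if h i == j then F i else idx).
  rewrite fsbig_supp.
  transitivity (\big[op/idx]_(i \in A `&` h @^-1` [set j])
                  (if h i == j then F i else idx)).
    have -> : A `&` h @^-1` [set j]
            = P `&` h @^-1` [set j] `&` F @^-1` [set~ idx].
      by rewrite setIAC.
    apply: eq_fsbigr => i; rewrite inE => -[[_ /= ->] _].
    by rewrite eqxx.
  apply: fsbig_widen; first by move=> i [].
  move=> i [Ai nAi] /=; case: eqP => // hij.
  by case: nAi.
transitivity (\big[op/idx]_(j \in h @` A)
    \big[op/idx]_(i \in A) (if h i == j then F i else idx)); last first.
  transitivity (\big[op/idx]_(j \in [set: J])
    \big[op/idx]_(i \in A) (if h i == j then F i else idx)).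
    apply: fsbig_widen => // j [_ nBj] /=.
    apply: fsbig1 => i Ai; case: eqP => // hij; case: nBj; by exists i.
  by apply: eq_fsbigr => j _; rewrite inner.
rewrite exchange_fsbig// fsbig_supp.
apply: eq_fsbigr => i; rewrite inE => Ai.
transitivity (\big[op/idx]_(j \in [set h i]) (if h i == j then F i else idx)).
  by rewrite fsbig_set1 eqxx.
apply: fsbig_widen; first by move=> _ ->; exists i.
by move=> j [_ /= nj]; case: eqP => // /esym.
Qed.

Lemma fsbig_neq_ex (I : choiceType) (P : set I) (F : I -> V) :
  \big[op/idx]_(i \in P) F i <> idx -> exists2 i, P i & F i <> idx.
Proof.
move=> F0; apply: contrapT => nex; apply: F0; apply: fsbig1 => i Pi.
by apply: contrapT => Fi; apply: nex; exists i.
Qed.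

Lemma fsbig_splitT (I : choiceType) (P : set I) (F H : I -> V) :
    finite_set (P `&` F @^-1` [set~ idx]) ->
    finite_set (P `&` H @^-1` [set~ idx]) ->
  \big[op/idx]_(i \in P) op (F i) (H i)
  = op (\big[op/idx]_(i \in P) F i) (\big[op/idx]_(i \in P) H i).
Proof.
move=> finF finH.
pose A := (P `&` F @^-1` [set~ idx]) `|` (P `&` H @^-1` [set~ idx]).
have finA : finite_set A by rewrite finite_setU.
have AP : A `<=` P by move=> i [[]|[]].
have AF i : (P `\` A) i -> F i = idx.
  by move=> [Pi nA]; apply: contrapT => Fi; apply: nA; left.
have AH i : (P `\` A) i -> H i = idx.
  by move=> [Pi nA]; apply: contrapT => Hi; apply: nA; right.
rewrite -!(fsbig_widen A P)//; first by rewrite !fsbig_finite// big_split.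
by move=> i Ai /=; rewrite AF// AH// Monoid.mul1m.
Qed.

End FiberSum.

Section FiniteSums.
Variable V : nmodType.

Lemma eq_fsum (I : choiceType) (P : set I) (F H : I -> V) :
  (forall i, P i -> F i = H i) -> \sum_(i \in P) F i = \sum_(i \in P) H i.
Proof. by move=> FH; apply: eq_fsbigr => i; rewrite inE; exact: FH. Qed.

Lemma fsum_widen (I : choiceType) (P D : set I) (F : I -> V) :
  P `<=` D -> (forall i, D i -> ~ P i -> F i = 0) ->
  \sum_(i \in P) F i = \sum_(i \in D) F i.
Proof. by move=> PD F0; apply: fsbig_widen => // i [Di nPi]; exact: F0. Qed.

Lemma fsum_split (I : choiceType) (P : set I) (F H : I -> V) :
    finite_set (P `&` F @^-1` [set~ 0]) ->
    finite_set (P `&` H @^-1` [set~ 0]) ->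
  \sum_(i \in P) (F i + H i) = \sum_(i \in P) F i + \sum_(i \in P) H i.
Proof. exact: fsbig_splitT. Qed.

Lemma fsum_fiber (I J : choiceType) (h : I -> J) (P : set I) (F : I -> V) :
  finite_set (P `&` F @^-1` [set~ 0]) ->
  \sum_(i \in P) F i
  = \sum_(j \in [set: J]) \sum_(i \in P `&` h @^-1` [set j]) F i.
Proof. exact: fsbig_fiber. Qed.

Lemma fsum_reindex (I J : choiceType) (h : I -> J) (P : set I) (Q : set J)
    (F : J -> V) : set_bij P Q h ->
  \sum_(j \in Q) F j = \sum_(i \in P) F (h i).
Proof. exact: reindex_fsbig. Qed.

Lemma fsum_neq_ex (I : choiceType) (P : set I) (F : I -> V) :
  \sum_(i \in P) F i <> 0 -> exists2 i, P i & F i <> 0.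
Proof. exact: fsbig_neq_ex. Qed.

End FiniteSums.

Lemma morph_fsum (V W : nmodType) (phi : V -> W) (I : choiceType)
    (P : set I) (F : I -> V) :
  phi 0 = 0 -> {morph phi : x y / x + y} ->
  finite_set (P `&` F @^-1` [set~ 0]) ->
  phi (\sum_(i \in P) F i) = \sum_(i \in P) phi (F i).
Proof.
move=> phi0 phiD finA; pose A := P `&` F @^-1` [set~ 0].
have AP : A `<=` P by move=> i [].
have AF i : P i -> ~ A i -> F i = 0.
  by move=> Pi nA; apply: contrapT => Fi; apply: nA.
rewrite -(fsum_widen AP)// -[RHS](fsum_widen AP)//; last first.
  by move=> i Pi Ai; rewrite AF.
by rewrite !fsbig_finite//= (big_morph phi phiD phi0).
Qed.

(* The conditions on S make the convolution product a finite sum at each      *)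
(* point, with support in S again.                                            *)
Record support_ideal (G : monoidType) := SupportIdeal {
  small :> set G -> Prop;
  small_set1 : forall x, small [set x];
  small_sub : forall A B, A `<=` B -> small B -> small A;
  smallU : forall A B, small A -> small B -> small (A `|` B);
  smallM : forall A B, small A -> small B ->
    small [set x | exists a b, [/\ A a, B b & (a * b)%g = x]];
  small_fiber : forall A B, small A -> small B -> forall x,
    finite_set [set p : G * G | [/\ A p.1, B p.2 & (p.1 * p.2)%g = x]]
}.

Section Convolution.
Variables (R : nzRingType) (G : monoidType) (S : support_ideal G).

Definition supp (f : G -> R) : set G := f @^-1` [set~ 0].

Record conv := Conv { coef :> G -> R; _ : `[< S (supp coef) >] }.
HB.instance Definition _ := [isSub for coef].
HB.instance Definition _ := [Choice of conv by <:].

Lemma conv_small (f : conv) : S (supp f).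
Proof. by case: f => f /= /asboolP. Qed.

Lemma convP (f g : conv) : (forall x, f x = g x) <-> f = g.
Proof. by split=> [fg|->//]; apply/val_inj/funext. Qed.

Lemma small0 : S set0.
Proof. by apply: small_sub (small_set1 S 1%g). Qed.

Fact conv0_small : `[< S (supp (fun=> 0 : R)) >].
Proof. by apply/asboolP; apply: small_sub small0 => x; exact. Qed.
Definition conv0 : conv := Conv conv0_small.

(* The operations are locked to keep unification from unfolding them.         *)
Fact conv_key : unit. Proof. exact: tt. Qed.

(* The function f itself if its support is in S (mkconvE), and 0 otherwise.   *)
Definition mkconv : (G -> R) -> conv := locked_with conv_key (insubd conv0).

Lemma mkconvE f : S (supp f) -> coef (mkconv f) = f.
Proof. by move=> Sf; rewrite /mkconv unlock insubdK//; apply/asboolP. Qed.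

Definition convD : conv -> conv -> conv :=
  locked_with conv_key (fun f g => mkconv (fun x => f x + g x)).
Definition convN : conv -> conv :=
  locked_with conv_key (fun f => mkconv (fun x => - f x)).
Definition convU : G -> R -> conv :=
  locked_with conv_key (fun g r => mkconv (fun x => if x == g then r else 0)).
Definition convM : conv -> conv -> conv :=
  locked_with conv_key (fun f g =>
    mkconv (fun x => \sum_(p \in [set p | (p.1 * p.2)%g = x]) f p.1 * g p.2)).

Lemma convDE f g x : convD f g x = f x + g x.
Proof.
rewrite /convD unlock mkconvE//.
apply: small_sub (smallU (conv_small f) (conv_small g)) => {}x /=.
rewrite /supp /=; have [->|fx] := pselect (f x = 0); last by left.
by rewrite add0r; right.
Qed.

Lemma convNE f x : convN f x = - f x.
Proof.
rewrite /convN unlock mkconvE//; apply: small_sub (conv_small f) => {}x /=.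
by apply: contra_not => /= ->; rewrite oppr0.
Qed.

Lemma convUE g r x : convU g r x = if x == g then r else 0.
Proof.
rewrite /convU unlock mkconvE//; apply: small_sub (small_set1 S g) => {}x /=.
by rewrite /supp /=; case: eqP.
Qed.

Lemma convM_fin (f g : conv) x :
  finite_set ([set p : G * G | (p.1 * p.2)%g = x] `&`
              (fun p => f p.1 * g p.2) @^-1` [set~ 0]).
Proof.
apply: sub_finite_set (small_fiber (conv_small f) (conv_small g) x).
move=> p [/= px fg]; split=> //; rewrite /supp /= => z.
  by apply: fg; rewrite /= z mul0r.
by apply: fg; rewrite /= z mulr0.
Qed.

Lemma convME f g x :
  convM f g x = \sum_(p \in [set p | (p.1 * p.2)%g = x]) f p.1 * g p.2.
Proof.
rewrite /convM unlock mkconvE//.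
apply: small_sub (smallM (conv_small f) (conv_small g)) => {}x /=.
rewrite /supp /= => /fsum_neq_ex [[a b] /= abx fg0].
exists a, b; split=> // z; apply: fg0; first by rewrite z mul0r.
by rewrite z mulr0.
Qed.

Lemma convDA : associative convD.
Proof. by move=> f g h; apply/convP => x; rewrite !convDE addrA. Qed.

Lemma convDC : commutative convD.
Proof. by move=> f g; apply/convP => x; rewrite !convDE addrC. Qed.

Lemma conv0D : left_id conv0 convD.
Proof. by move=> f; apply/convP => x; rewrite !convDE add0r. Qed.

Lemma convND : left_inverse conv0 convN convD.
Proof. by move=> f; apply/convP => x; rewrite !convDE convNE addNr. Qed.

HB.instance Definition _ := GRing.isZmodule.Build conv convDA convDC conv0D convND.

Definition conv1 : conv := convU 1%g 1.

Lemma convMA : associative convM.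
Proof.
move=> f g h; apply/convP => x.
have fin3 : finite_set ([set t : G * G * G | (t.1.1 * t.1.2 * t.2)%g = x] `&`
    (fun t : G * G * G => f t.1.1 * g t.1.2 * h t.2) @^-1` [set~ 0]).
  pose K := small_fiber (smallM (conv_small f) (conv_small g)) (conv_small h) x.
  pose L u := small_fiber (conv_small f) (conv_small g) u.
  have finU := bigcup_finite K (fun u _ => finite_image (fun p : G * G => (p, u.2))
    (L u.1)).
  apply: sub_finite_set finU => -[[a b] c] /= [abc n0].
  have fa : f a <> 0 by move=> z; apply: n0; rewrite z !mul0r.
  have gb : g b <> 0 by move=> z; apply: n0; rewrite z mulr0 mul0r.
  have hc : h c <> 0 by move=> z; apply: n0; rewrite z mulr0.
  exists ((a * b)%g, c) => /=; first by split=> //; exists a, b.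
  by exists (a, b) => //; split.
transitivity (\sum_(t \in [set t : G * G * G | (t.1.1 * t.1.2 * t.2)%g = x])
    f t.1.1 * g t.1.2 * h t.2).
  rewrite (fsum_fiber (fun t : G * G * G => (t.1.1, (t.1.2 * t.2)%g)) fin3).
  rewrite convME.
  transitivity (\sum_(p \in [set p | (p.1 * p.2)%g = x])
      \sum_(t \in [set t : G * G * G | (t.1.1 * t.1.2 * t.2)%g = x] `&`
             (fun t : G * G * G => (t.1.1, (t.1.2 * t.2)%g)) @^-1` [set p])
        f t.1.1 * g t.1.2 * h t.2); last first.
    apply: fsum_widen => // -[a u] _ /= nx.
    rewrite fsbig1// => -[[a' b] c] /= [abc [aa bc]].
    by case: nx; rewrite -aa -bc mulgA.
  apply: eq_fsum => -[a u] /= aux.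
  rewrite convME (morph_fsum (mulr0 (f a)) (mulrDr (f a))); last exact: convM_fin.
  apply/esym.
  etransitivity; first apply: (@fsum_reindex _ _ _ (fun p => (a, p.1, p.2))
    [set p | (p.1 * p.2)%g = u]); last first.
    by apply: eq_fsum => -[b c] _ /=; rewrite mulrA.
  split.
  - by move=> [b c] /= bc; rewrite -mulgA bc.
  - by move=> [b c] [b' c'] _ _ [-> ->].
  - by move=> [[a' b] c] /= [_ [<- bc]]; exists (b, c).
rewrite (fsum_fiber (fun t : G * G * G => ((t.1.1 * t.1.2)%g, t.2)) fin3).
rewrite convME.
transitivity (\sum_(p \in [set p | (p.1 * p.2)%g = x])
    \sum_(t \in [set t : G * G * G | (t.1.1 * t.1.2 * t.2)%g = x] `&`
           (fun t : G * G * G => ((t.1.1 * t.1.2)%g, t.2)) @^-1` [set p])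
      f t.1.1 * g t.1.2 * h t.2).
  apply/esym; apply: fsum_widen => // -[u c] _ /= nx.
  rewrite fsbig1// => -[[a b] c'] /= [abc [ab cc]].
  by case: nx; rewrite -cc -ab.
apply: eq_fsum => -[u c] /= aux.
rewrite convME (@morph_fsum _ _ ( *%R^~ (h c)) _ _ _ (mul0r _) (fun _ _ => mulrDl _ _ _)); last exact: convM_fin.
etransitivity; first apply: (@fsum_reindex _ _ _ (fun p => (p.1, p.2, c))
  [set p | (p.1 * p.2)%g = u]); last by [].
split.
- by move=> [a b] /= ab; rewrite ab.
- by move=> [a b] [a' b'] _ _ [-> ->].
- by move=> [[a b] c'] /= [_ [ab <-]]; exists (a, b).
Qed.

Lemma conv1M : left_id conv1 convM.
Proof.
move=> f; apply/convP => x; rewrite convME.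
rewrite -(fsum_widen (P := [set (1%g, x)])) ?fsbig_set1 /= ?convUE ?eqxx ?mul1r//.
  by move=> _ -> /=; rewrite mul1g.
move=> [a b] /= abx n1; rewrite convUE; case: eqP => [a1|]; last by rewrite mul0r.
by case: n1; rewrite -abx a1 mul1g.
Qed.

Lemma convM1 : right_id conv1 convM.
Proof.
move=> f; apply/convP => x; rewrite convME.
rewrite -(fsum_widen (P := [set (x, 1%g)])) ?fsbig_set1 /= ?convUE ?eqxx ?mulr1//.
  by move=> _ -> /=; rewrite mulg1.
move=> [a b] /= abx n1; rewrite convUE; case: eqP => [b1|]; last by rewrite mulr0.
by case: n1; rewrite -abx b1 mulg1.
Qed.

Lemma convMDl : left_distributive convM +%R.
Proof.
move=> f g h; apply/convP => x; rewrite [RHS]convDE !convME -fsum_split.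
- by apply: eq_fsum => p _; rewrite convDE mulrDl.
- exact: convM_fin.
- exact: convM_fin.
Qed.

Lemma convMDr : right_distributive convM +%R.
Proof.
move=> f g h; apply/convP => x; rewrite [RHS]convDE !convME -fsum_split.
- by apply: eq_fsum => p _; rewrite convDE mulrDr.
- exact: convM_fin.
- exact: convM_fin.
Qed.

Lemma conv1_neq0 : conv1 != 0.
Proof.
apply/eqP => /convP /(_ 1%g); rewrite convUE eqxx /= => /eqP.
by rewrite oner_eq0.
Qed.

HB.instance Definition _ := GRing.Zmodule_isNzRing.Build conv
  convMA conv1M convM1 convMDl convMDr conv1_neq0.

End Convolution.

Section ConvUnit.
Variables (R : nzRingType) (G : monoidType) (S : support_ideal G).
Implicit Types f g : conv R S.

Definition conv_unit : pred (conv R S) :=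
  locked_with conv_key (fun f => `[< exists g, g * f = 1 /\ f * g = 1 >]).

Definition conv_inv : conv R S -> conv R S :=
  locked_with conv_key (fun f => xget f [set g | g * f = 1 /\ f * g = 1]).

Lemma conv_unitE f : conv_unit f <-> exists g, g * f = 1 /\ f * g = 1.
Proof. by rewrite /conv_unit unlock; split=> [/asboolP|/asboolP]. Qed.

Fact conv_invP f : conv_unit f -> conv_inv f * f = 1 /\ f * conv_inv f = 1.
Proof. by rewrite /conv_inv unlock => /conv_unitE /(xgetPex f). Qed.

Fact conv_mulVr : {in conv_unit, left_inverse 1 conv_inv *%R}.
Proof. by move=> f /conv_invP []. Qed.

Fact conv_mulrV : {in conv_unit, right_inverse 1 conv_inv *%R}.
Proof. by move=> f /conv_invP []. Qed.

Fact conv_unitP f g : g * f = 1 /\ f * g = 1 -> conv_unit f.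
Proof. by move=> fg; apply/conv_unitE; exists g. Qed.

Fact conv_inv_out : {in [predC conv_unit], conv_inv =1 id}.
Proof.
move=> f /negP nf; rewrite /conv_inv unlock; case: xgetP => // g _ /= fg.
by case: nf; exact: (conv_unitP fg).
Qed.

HB.instance Definition _ := GRing.NzRing_hasMulInverse.Build (conv R S)
  conv_mulVr conv_mulrV conv_unitP conv_inv_out.

End ConvUnit.

Lemma convMC (R : comNzRingType) (G : monoidType) (S : support_ideal G) :
  (forall x y : G, x * y = y * x)%g -> commutative (@convM R G S).
Proof.
move=> GC f g; apply/convP => x; rewrite !convME.
etransitivity; first apply: (@fsum_reindex _ _ _ (fun p => (p.2, p.1))
  [set p | (p.1 * p.2)%g = x]).
  split.
  - by move=> [a b] /= <-; rewrite GC.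
  - by move=> [a b] [a' b'] _ _ [-> ->].
  - by move=> [a b] /= <-; exists (b, a) => //=; rewrite GC.
by apply: eq_fsum => -[a b] _ /=; rewrite mulrC.
Qed.

Lemma convUM (R : nzRingType) (G : monoidType) (S : support_ideal G)
    (g h : G) (a b : R) :
  convU S g a * convU S h b = convU S (g * h)%g (a * b).
Proof.
apply/convP => x; rewrite convME convUE.
have [->|xgh] := eqVneq x (g * h)%g.
  rewrite -(fsum_widen (P := [set (g, h)])) ?fsbig_set1 /= ?convUE ?eqxx//.
    by move=> _ ->.
  move=> [u v] /= _ n; rewrite !convUE.
  case: eqP => [ug|]; last by rewrite mul0r.
  case: eqP => [vh|]; last by rewrite mulr0.
  by case: n; rewrite ug vh.
rewrite fsbig1// => -[u v] /= uv; rewrite !convUE.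
case: eqP => [ug|]; last by rewrite mul0r.
case: eqP => [vh|]; last by rewrite mulr0.
by rewrite -uv ug vh eqxx in xgh.
Qed.

Section FiniteSupport.
Variable G : monoidType.

Fact finite_set_union (A B : set G) :
  finite_set A -> finite_set B -> finite_set (A `|` B).
Proof. by move=> fA fB; rewrite finite_setU. Qed.

Fact finite_setM (A B : set G) : finite_set A -> finite_set B ->
  finite_set [set x | exists a b, [/\ A a, B b & (a * b)%g = x]].
Proof.
move=> fA fB; have := finite_image (fun p => (p.1 * p.2)%g) (finite_setX fA fB).
apply: sub_finite_set => x [a [b [Aa Bb <-]]]; by exists (a, b).
Qed.

Fact finite_fiber (A B : set G) : finite_set A -> finite_set B -> forall x,
  finite_set [set p : G * G | [/\ A p.1, B p.2 & (p.1 * p.2)%g = x]].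
Proof.
move=> fA fB x; apply: sub_finite_set (finite_setX fA fB).
by move=> [a b] [].
Qed.

Definition finite_ideal : support_ideal G := @SupportIdeal G (@finite_set G)
  (@finite_set1 G) (@sub_finite_set G)
  finite_set_union finite_setM finite_fiber.

End FiniteSupport.

(* The additive group of integers as a (multiplicative) monoidType.           *)
Notation Zm := (Algebra.to_multiplicative int).

Definition ubounded (A : set Zm) := exists N : int, forall m : int, A m -> m <= N.

Fact ubounded1 x : ubounded [set x].
Proof. by exists x => m ->. Qed.

Fact ubounded_sub A B : A `<=` B -> ubounded B -> ubounded A.
Proof. by move=> AB [N BN]; exists N => m /AB /BN. Qed.

Fact uboundedU A B : ubounded A -> ubounded B -> ubounded (A `|` B).
Proof.
move=> [N AN] [M BM]; exists (Num.max N M) => m; rewrite le_max.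
by move=> [/AN ->|/BM ->]; rewrite ?orbT.
Qed.

Fact uboundedM A B : ubounded A -> ubounded B ->
  ubounded [set x | exists a b, [/\ A a, B b & (a * b)%g = x]].
Proof.
move=> [N AN] [M BM]; exists (N + M) => m [a [b [/AN aN /BM bM <-]]].
exact: lerD.
Qed.

Fact ubounded_fiber A B : ubounded A -> ubounded B -> forall x,
  finite_set [set p : Zm * Zm | [/\ A p.1, B p.2 & (p.1 * p.2)%g = x]].
Proof.
move=> [N AN] [M BM] x.
pose h (i : nat) : Zm * Zm := (N - i%:Z, (x : int) - (N - i%:Z)).
have : finite_set (h @` `I_(absz (N + M - (x : int))%R).+1) by exact/finite_image/finite_II.
apply: sub_finite_set => -[a b] /= [/AN aN /BM bM abx].
have {}abx : (a : int) + b = x by [].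
have aNi : N - (absz (N - a))%:Z = a by rewrite gez0_abs ?subr_ge0// subKr.
exists (absz (N - a)); last by rewrite /h aNi -abx addrC addKr.
rewrite /= ltnS -lez_nat !gez0_abs ?subr_ge0//.
  by rewrite -abx opprD addrACA lerDl subr_ge0.
by rewrite -abx lerD.
Qed.

Definition ubounded_ideal : support_ideal Zm := @SupportIdeal Zm ubounded
  ubounded1 ubounded_sub uboundedU uboundedM ubounded_fiber.

Fact ZmC (x y : Zm) : (x * y = y * x)%g.
Proof. exact: (@addrC int). Qed.

Definition lser (R : nzRingType) := conv R ubounded_ideal.
HB.instance Definition _ (R : nzRingType) := GRing.UnitRing.on (lser R).
HB.instance Definition _ (R : comNzRingType) :=
  GRing.PzSemiRing_hasCommutativeMul.Build (lser R) (convMC ZmC).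

Definition laurent (R : nzRingType) := conv R (finite_ideal Zm).
HB.instance Definition _ (R : nzRingType) := GRing.UnitRing.on (laurent R).
HB.instance Definition _ (R : comNzRingType) :=
  GRing.PzSemiRing_hasCommutativeMul.Build (laurent R) (convMC ZmC).

Fact Zm2C (x y : (Zm * Zm)%type) : (x * y = y * x)%g.
Proof. by case: x y => [a b] [c d]; congr pair; exact: (@addrC int). Qed.

Definition laurent2 (R : nzRingType) := conv R (finite_ideal (Zm * Zm)%type).
HB.instance Definition _ (R : nzRingType) := GRing.UnitRing.on (laurent2 R).
HB.instance Definition _ (R : comNzRingType) :=
  GRing.PzSemiRing_hasCommutativeMul.Build (laurent2 R) (convMC Zm2C).

(* The integral Heisenberg group; (c, i, j) stands for q^c x^i y^j, and       *)
(* y^j x^i' = q^(j i') x^i' y^j gives the product. Its group algebra is A.    *)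
Definition heis := (int * int * int)%type.
HB.instance Definition _ := Choice.on heis.

Definition heis_mul (g h : heis) : heis :=
  let: (c, i, j) := g in let: (c', i', j') := h in
  (c + c' + j * i', i + i', j + j').

Fact heis_mulA : associative heis_mul.
Proof.
move=> [[c i] j] [[c' i'] j'] [[c'' i''] j'']; rewrite /heis_mul.
by congr (_, _, _); ring.
Qed.

Fact heis_mul1g : left_id ((0, 0, 0) : heis) heis_mul.
Proof. by move=> [[c i] j]; rewrite /heis_mul !add0r mul0r addr0. Qed.

Fact heis_mulg1 : right_id ((0, 0, 0) : heis) heis_mul.
Proof. by move=> [[c i] j]; rewrite /heis_mul !addr0 mulr0 addr0. Qed.

HB.instance Definition _ := isMonoid.Build heis heis_mulA heis_mul1g heis_mulg1.

Definition qtorus (k : nzRingType) := conv k (finite_ideal heis).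
HB.instance Definition _ (k : nzRingType) := GRing.UnitRing.on (qtorus k).

Section LaurentSeries.
Variable R : nzRingType.

Definition lserC (a : R) : lser R := convU ubounded_ideal (0 : int) a.
Definition lambda : lser R := convU ubounded_ideal (1 : int) 1.

(* Sum of a family of series in which each power of lambda receives finitely  *)
(* many nonzero contributions.                                                *)
Definition lsum (I : choiceType) (u : I -> lser R) : lser R :=
  mkconv ubounded_ideal (fun m => \sum_(i \in [set: I]) u i m).

Definition lexp (f : lser R) : lser R :=
  lsum (fun m : nat => f ^+ m / (m`!)%:R).

Definition llog (f : lser R) : lser R :=
  lsum (fun m : nat => (-1) ^+ m * (f - 1) ^+ m.+1 / m.+1%:R).

(* F(G) = \sum_i F_i G^i, where i ranges over the integers.                   *)
Definition lcomp (F G : lser R) : lser R :=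
  lsum (fun i : int => lserC (F i) * G ^ i).

Definition is_compinv (G F : lser R) : Prop :=
  [/\ F (1 : int) = 1, forall m : int, 1 < m -> F m = 0 & lcomp F G = lambda].

(* The series F with leading term u such that F(G(lambda)) = lambda.          *)
Definition compinv (G : lser R) : lser R := xget 0 [set F | is_compinv G F].

End LaurentSeries.

Arguments lambda {R}.

(* Coefficientwise application of an additive map phi.                        *)
Definition map_conv (R R' : nzRingType) (G : monoidType) (S : support_ideal G)
    (phi : R -> R') (f : conv R S) : conv R' S :=
  mkconv S (fun x => phi (f x)).

Section QuantumTorus.
Variable k : nzRingType.

Definition qmon (c i j : int) : qtorus k :=
  convU (finite_ideal heis) (c, i, j) 1.
Definition qA : qtorus k := qmon 1 0 0.
Definition xA : qtorus k := qmon 0 1 0.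
Definition yA : qtorus k := qmon 0 0 1.

Lemma qmonM c i j c' i' j' :
  qmon c i j * qmon c' i' j' = qmon (c + c' + j * i') (i + i') (j + j').
Proof. by rewrite /qmon convUM mulr1. Qed.

Lemma qmon1 : qmon 0 0 0 = 1.
Proof. by []. Qed.

Lemma qmon_unit c i j : qmon c i j \is a GRing.unit.
Proof.
apply/unitrP; exists (qmon (i * j - c) (- i) (- j)).
by split; rewrite qmonM -qmon1; congr qmon; ring.
Qed.

Lemma yxA : yA * xA = qA * xA * yA.
Proof. by rewrite /yA /xA /qA !qmonM; congr qmon; ring. Qed.

Lemma qA_central a : qA * a = a * qA.
Proof.
rewrite /qA /qmon; apply/convP => -[[c i] j]; rewrite !convME.
rewrite -(fsum_widen (P := [set ((1, 0, 0) : heis, (c - 1, i, j) : heis)])).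
- rewrite -[RHS](fsum_widen (P := [set ((c - 1, i, j) : heis, (1, 0, 0) : heis)])).
  + by rewrite !fsbig_set1 !convUE eqxx mul1r mulr1.
  + by move=> _ -> /=; congr (_, _, _); ring.
  + move=> [[[u1 u2] u3] v] /= uv n; rewrite convUE; case: eqP => [v1|].
      case: n; move: uv; rewrite v1 => -[<- <- <-].
      by congr ((_, _, _), _); ring.
    by rewrite mulr0.
- by move=> _ -> /=; congr (_, _, _); ring.
- move=> [v [[u1 u2] u3]] /= uv n; rewrite convUE; case: eqP => [v1|].
    case: n; move: uv; rewrite v1 => -[<- <- <-].
    by congr (_, (_, _, _)); ring.
  by rewrite mul0r.
Qed.

(* Coefficient at x^i y^j, an element of k[q, q^-1].                          *)
Definition Coeff (i j : int) (a : qtorus k) : laurent k :=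
  mkconv (finite_ideal Zm) (fun c : int => a (c, i, j)).

Definition D : lser (qtorus k) :=
  lambda - lserC xA - lserC yA + lserC (xA^-1 * yA^-1).

(* Coeff_(0,0) is applied to each coefficient of a series in lambda^-1.       *)
Definition Gq : lser (laurent k) :=
  lambda * lexp (map_conv (Coeff 0 0) (llog (lambda^-1 * D))).

Definition eval1 (u : laurent k) : k := \sum_(c \in [set: Zm]) u c.

(* G_q at q = 1.                                                              *)
Definition G1 : lser k := map_conv eval1 Gq.

Definition Finv : lser k := compinv G1.

Definition laurentC (a : k) : laurent k := convU (finite_ideal Zm) (0 : int) a.

End QuantumTorus.

(* Here n.+1 is the dimension of the representation, so that n.+1 ranges over *)
(* the integers >= 1. As q is already invertible in k[q]/Phi_(n.+1)(q)        *)
(* (zeta_unit), {poly %/ Phi} is also k[q, q^-1]/Phi_(n.+1)(q), with zeta the *)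
(* class of q.                                                                *)
Section Representation.
Variables (k : fieldType) (n : nat).

Definition Phi : {poly k} := map_poly intr 'Phi_n.+1.

Lemma mk_monic_Phi : mk_monic Phi = Phi.
Proof.
rewrite /mk_monic.
have m : map_poly intr 'Phi_n.+1 \is @monic k by rewrite monic_map ?Cyclotomic_monic.
rewrite ifT// {2}/Phi m andbT /Phi.
by rewrite size_map_poly_id0 ?(monicP (Cyclotomic_monic _)) ?rmorph1 ?oner_eq0//
  size_Cyclotomic ltnS totient_gt0.
Qed.

Definition Kzeta : comUnitRingType := {poly %/ Phi}.

Definition zeta : Kzeta := 'qX.

Lemma zetaX : zeta ^+ n.+1 = 1.
Proof.
rewrite /zeta /qpolyX -rmorphXn /=; apply/eqP; rewrite -subr_eq0.
rewrite -(rmorph1 (in_qpoly _)) -rmorphB /=.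
have /(congr1 (map_poly (intr : int -> k))) := prod_Cyclotomic (ltn0Sn n).
rewrite rmorphB /= map_polyXn rmorph1 => <-.
rewrite (big_rem n.+1) /= ?divisors_id// rmorphM /= in_qpolyM.
suff -> : in_qpoly Phi (map_poly intr 'Phi_n.+1) = 0 by rewrite mul0r.
apply: val_inj; rewrite /= mk_monic_Phi Pdiv.RingMonic.rmodpp //.
by have := monic_mk_monic Phi; rewrite mk_monic_Phi.
Qed.

Lemma zeta_unit : zeta \is a GRing.unit.
Proof. by rewrite -(unitrX_pos _ (ltn0Sn n)) zetaX unitr1. Qed.

(* Reduction k[q, q^-1] -> k[q, q^-1]/Phi_(n.+1)(q).                          *)
Definition modPhi (u : laurent k) : Kzeta :=
  \sum_(c \in [set: Zm]) qpolyC Phi (u c) * zeta ^ c.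

(* (k[q]/Phi_(n.+1)(q))[xi, xi^-1, eta, eta^-1].                              *)
Definition Kxe : comUnitRingType := laurent2 Kzeta.

Definition scalC (a : Kzeta) : Kxe :=
  convU (finite_ideal (Zm * Zm)%type) ((0, 0) : int * int) a.
Definition Xi : Kxe :=
  convU (finite_ideal (Zm * Zm)%type) ((1, 0) : int * int) 1.
Definition Eta : Kxe :=
  convU (finite_ideal (Zm * Zm)%type) ((0, 1) : int * int) 1.

Lemma scalCM a b : scalC (a * b) = scalC a * scalC b.
Proof. by rewrite /scalC convUM mulg1. Qed.

Lemma Xi_unit : Xi \is a GRing.unit.
Proof.
apply/unitrP; exists (convU (finite_ideal (Zm * Zm)%type) ((-1, 0) : int * int) 1).
by split; rewrite /Xi convUM mulr1.
Qed.

Lemma Eta_unit : Eta \is a GRing.unit.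
Proof.
apply/unitrP; exists (convU (finite_ideal (Zm * Zm)%type) ((0, -1) : int * int) 1).
by split; rewrite /Eta convUM mulr1.
Qed.

Lemma scalC_unit a : a \is a GRing.unit -> scalC a \is a GRing.unit.
Proof.
move=> ua; apply/unitrP; exists (scalC a^-1).
by split; rewrite -scalCM ?mulVr ?mulrV.
Qed.

(* Matrices acting on columns: x v_j = xi v_(j+1), y v_j = q^j eta v_j, with  *)
(* j + 1 taken modulo n.+1 (ordS).                                            *)
Definition rho_x : 'M[Kxe]_n.+1 :=
  \matrix_(i, j) (if i == ordS j then Xi else 0).
Definition rho_y : 'M[Kxe]_n.+1 :=
  diag_mx (\row_j (scalC (zeta ^+ j) * Eta)).

Lemma rho_y_unit : rho_y \is a GRing.unit.
Proof.
change (rho_y \in unitmx); rewrite unitmxE det_diag; apply: rpred_prod => j _; rewrite mxE.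
by rewrite unitrM Eta_unit andbT scalC_unit// unitrX// zeta_unit.
Qed.

Lemma rho_x_unit : rho_x \is a GRing.unit.
Proof.
pose Y : 'M[Kxe]_n.+1 := \matrix_(i, j) (if j == ordS i then Xi^-1 else 0).
change (rho_x \in unitmx).
suff XY : rho_x *m Y = 1%:M by have [] := mulmx1_unit XY.
apply/matrixP => i j; rewrite !mxE (bigD1 (ord_pred i)) //= big1 => [|l li].
  rewrite !mxE ord_predK eqxx addr0 eq_sym; case: eqP => _; last by rewrite mulr0.
  by rewrite mulrV// Xi_unit.
rewrite !mxE; case: eqP => [il|]; last by rewrite mul0r.
by rewrite il ordSK eqxx in li.
Qed.

Lemma rho_yx : rho_y * rho_x = (scalC zeta)%:M * rho_x * rho_y.
Proof.
rewrite -!mulmxE mul_scalar_mx; apply/matrixP => i j.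
rewrite mul_diag_mx mul_mx_diag !mxE; case: eqP => [->|]; last by rewrite mulr0 mulr0 mul0r.
have -> : zeta ^+ (ordS j) = zeta * zeta ^+ j.
  rewrite /= -exprS; symmetry; rewrite {1}(divn_eq j.+1 n.+1).
  by rewrite exprD mulnC exprM zetaX expr1n mul1r.
rewrite scalCM; ring.
Qed.

(* The k-linear map with q^c x^i y^j |-> q^c rho(x)^i rho(y)^j (rho_mon); it  *)
(* respects y x = q x y by rho_yx.                                            *)
Definition rho (a : qtorus k) : 'M[Kxe]_n.+1 :=
  \sum_(g \in [set: heis])
    (scalC (qpolyC Phi (a g) * zeta ^ g.1.1))%:M * rho_x ^ g.1.2 * rho_y ^ g.2.

Lemma rho_mon c i j :
  rho (qmon k c i j) = (scalC (zeta ^ c))%:M * rho_x ^ i * rho_y ^ j.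
Proof.
rewrite /rho -(fsum_widen (P := [set ((c, i, j) : heis)]))//.
  by rewrite fsbig_set1 convUE eqxx rmorph1 mul1r.
move=> g _ gn; rewrite convUE; case: eqP => // _.
rewrite rmorph0 mul0r (_ : scalC 0 = 0); first by rewrite raddf0 !mul0r.
by apply/convP => x; rewrite convUE if_same.
Qed.

Definition rho_ser (f : lser (qtorus k)) : 'M[lser Kxe]_n.+1 :=
  \matrix_(i, j) map_conv (fun a => rho a i j) f.

Definition modPhi_ser (f : lser (laurent k)) : lser Kxe :=
  map_conv (fun u => scalC (modPhi u)) f.

End Representation.

(* Main.v *)
From HB Require Import structures.
Require Import Defs.
From mathcomp Require Import all_boot all_order all_algebra all_field.
From mathcomp Require Import finmap mathcomp_extra boolp classical_sets functions.
From mathcomp Require Import cardinality fsbigop ring zify.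

(* Let [W = x + y - x^-1 y^-1], so that [D = lambda - W] and [rho(D)] is the
   characteristic matrix of [A = rho(W)]. The trace of [rho(x^i y^j)] vanishes
   unless [N = n.+1] divides [i] and [j], and the Newton polygon of [W^l] is [l]
   times a triangle; hence, by Newton's identities, [det rho(D) = P - W_N] with
   [P] a monic polynomial of degree [N] in [lambda], free of [xi] and [eta], and
   [W_N = xi^N + eta^N - xi^-N eta^-N].

   With [delta = lambda d/dlambda] and [c_m(q) = Coeff_00(W^m)], the definition
   of [G_q] becomes [delta G_q = G_q * \sum_m c_m(q) lambda^-m], which disposes of
   [exp] and [log]. Jacobi's formula reads
   [delta (det rho(D)) = det rho(D) * \sum_m tr(A^m) lambda^-m]. Dividing by
   [det rho(D) = P - W_N] and taking the terms of degree 0 in [xi] and [eta] gives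
   [delta P * \sum_m c_m(1) P^(-m-1) = N * \sum_m c_m(q) lambda^-m], since the
   constant term of [W_N^m] is [c_m(1)]. It follows that [G_q^N] and [G_1(P)]
   satisfy the same equation [delta f = f h]; both have leading term [lambda^N],
   so they are equal and [F(G_q^N) = F(G_1(P)) = P]. *)

Set Implicit Arguments.
Unset Strict Implicit.
Unset Printing Implicit Defensive.

Import Order.TTheory GRing.Theory Num.Theory.
Local Open Scope classical_set_scope.
Local Open Scope ring_scope.

(** * Coefficients and coefficientwise maps in convolution algebras *)

Section ConvCoef.
Variables (R : nzRingType) (G : monoidType) (S : support_ideal G).
Implicit Types f g : conv R S.

Lemma conv_coef0 x : (0 : conv R S) x = 0. Proof. by []. Qed.

Lemma conv_coefD f g x : (f + g) x = f x + g x. Proof. exact: convDE. Qed.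

Lemma conv_coefN f x : (- f) x = - f x. Proof. exact: convNE. Qed.

Lemma conv_coefB f g x : (f - g) x = f x - g x.
Proof. by rewrite conv_coefD conv_coefN. Qed.

Lemma conv_coef_sum (I : Type) (r : seq I) (P : pred I) (F : I -> conv R S) x :
  (\sum_(i <- r | P i) F i) x = \sum_(i <- r | P i) F i x.
Proof. by apply: (big_morph (fun f : conv R S => f x)) => // f g; rewrite conv_coefD. Qed.

Lemma conv_coefMn f m x : (f *+ m) x = f x *+ m.
Proof. by elim: m => [|m IH]; rewrite ?mulr0n// !mulrS conv_coefD IH. Qed.

Lemma conv_coef1 x : (1 : conv R S) x = if x == 1%g then 1 else 0.
Proof. exact: convUE. Qed.

Lemma conv_coefM f g x :
  (f * g) x = \sum_(p \in [set p | (p.1 * p.2)%g = x]) f p.1 * g p.2.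
Proof. exact: convME. Qed.

Lemma conv_natr (n : nat) : n%:R = convU S 1%g n%:R :> conv R S.
Proof.
apply/convP => x; rewrite conv_coefMn conv_coef1 convUE.
by case: ifP; rewrite ?mul0rn.
Qed.

Lemma convU_is_additive (x : G) : zmod_morphism (@convU R G S x).
Proof.
by move=> a b; apply/convP => y; rewrite conv_coefB !convUE; case: ifP; rewrite ?subr0.
Qed.

HB.instance Definition _ (x : G) :=
  GRing.isZmodMorphism.Build R (conv R S) (convU S x) (convU_is_additive x).

End ConvCoef.

Section MapConv.
Variables (R R' : nzRingType) (G : monoidType) (S : support_ideal G).

Lemma map_convE (phi : R -> R') (f : conv R S) x :
  phi 0 = 0 -> map_conv phi f x = phi (f x).
Proof.
move=> phi0; rewrite /map_conv mkconvE//.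
apply: small_sub (conv_small f) => {}x /=; rewrite /supp /=.
by apply: contra_not => ->.
Qed.

Lemma map_conv_is_additive (phi : {additive R -> R'}) :
  zmod_morphism (map_conv (S := S) phi).
Proof.
by move=> f g; apply/convP => x; rewrite conv_coefB !map_convE ?raddf0// conv_coefB raddfB.
Qed.

HB.instance Definition _ (phi : {additive R -> R'}) :=
  GRing.isZmodMorphism.Build (conv R S) (conv R' S) (map_conv phi)
    (map_conv_is_additive phi).

Lemma map_convU (phi : {additive R -> R'}) x a :
  map_conv phi (convU S x a) = convU S x (phi a).
Proof.
apply/convP => y; rewrite map_convE ?raddf0// !convUE.
by case: ifP => // _; rewrite raddf0.
Qed.

Lemma map_conv_is_multiplicative (phi : {rmorphism R -> R'}) :
  monoid_morphism (map_conv (S := S) phi).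
Proof.
split.
  apply/convP => x; rewrite map_convE ?rmorph0// !conv_coef1.
  by case: ifP; rewrite ?rmorph1 ?rmorph0.
move=> f g; apply/convP => x; rewrite map_convE ?rmorph0// !conv_coefM.
rewrite (morph_fsum (rmorph0 phi) (rmorphD phi)); last exact: convM_fin.
by apply: eq_fsum => p _; rewrite rmorphM !map_convE ?rmorph0.
Qed.

HB.instance Definition _ (phi : {rmorphism R -> R'}) :=
  GRing.isMonoidMorphism.Build (conv R S) (conv R' S) (map_conv phi)
    (map_conv_is_multiplicative phi).

End MapConv.

Lemma map_conv_id (R : nzRingType) (G : monoidType) (S : support_ideal G)
    (f : conv R S) : map_conv idfun f = f.
Proof. by apply/convP => x; rewrite map_convE. Qed.

(** Intended for maps [pi] that are only linear over the scalars, such as the constant term in [xi]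
    and [eta]: the scalar factor passes through each summand of the convolution. *)
Lemma map_convM_scal (R R' R'' : nzRingType) (G : monoidType)
    (S : support_ideal G) (phi : {additive R -> R'}) (pi : {additive R' -> R''})
    (psi : {additive R -> R''}) (f : conv R' S) (g : conv R S) :
  (forall x y, pi (y * phi x) = pi y * psi x) ->
  map_conv pi (f * map_conv phi g) = map_conv pi f * map_conv psi g.
Proof.
move=> piM; apply/convP => x; rewrite map_convE ?raddf0// !conv_coefM.
rewrite (morph_fsum (raddf0 pi) (raddfD pi)); last exact: convM_fin.
by apply: eq_fsum => p _; rewrite !map_convE ?raddf0.
Qed.

(** * Laurent series in [lambda^-1] *)

Section Degree.
Variable R : nzRingType.
Implicit Types (f g : lser R) (a b m : int).

Definition dle f a := forall m : int, a < m -> f m = 0.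

Lemma coefU_lser (i : int) (c : R) (m : int) :
  convU ubounded_ideal i c m = if m == i then c else 0.
Proof. exact: convUE. Qed.

Lemma ser_coef1 (m : int) : (1 : lser R) m = if m == 0 then 1 else 0.
Proof. exact: convUE. Qed.

Lemma dle_ex f : exists a, dle f a.
Proof.
have [N fN] := conv_small f; exists N => m Nm.
by apply: contrapT => /fN; rewrite leNgt Nm.
Qed.

Lemma dleW f a b : a <= b -> dle f a -> dle f b.
Proof. by move=> ab fa m bm; apply: fa; apply: le_lt_trans bm. Qed.

Lemma dleN f a : dle f a -> dle (- f) a.
Proof. by move=> fa m am; rewrite conv_coefN fa ?oppr0. Qed.

Lemma dleD f g a : dle f a -> dle g a -> dle (f + g) a.
Proof. by move=> fa ga m am; rewrite conv_coefD fa ?ga ?addr0. Qed.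

Lemma dleB f g a : dle f a -> dle g a -> dle (f - g) a.
Proof. by move=> fa /dleN; exact: dleD. Qed.

Lemma dle_sum (I : Type) (r : seq I) (P : pred I) (F : I -> lser R) a :
  (forall i, P i -> dle (F i) a) -> dle (\sum_(i <- r | P i) F i) a.
Proof.
move=> Fa; apply: (big_ind (fun f => dle f a)) => //.
by move=> ? ?; exact: dleD.
Qed.

Lemma dleU (i : int) c : dle (convU ubounded_ideal i c) i.
Proof. by move=> m im; rewrite coefU_lser gt_eqF. Qed.

Lemma dle_eq0 f : (forall n : nat, dle f (- n%:Z)) -> f = 0.
Proof.
move=> f0; apply/convP => m; rewrite conv_coef0; 
have := f0 (absz (m : int)).+1 m; apply; rewrite /Zm /= in m *; lia.
Qed.

Lemma dleM f g a b : dle f a -> dle g b -> dle (f * g) (a + b).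
Proof.
move=> fa gb m abm; rewrite conv_coefM fsbig1// => -[i j] /= ijm.
have {ijm} : (i : int) + (j : int) = m by [].
have [ai _|ia ijm] := ltP a i; first by rewrite fa ?mul0r.
by rewrite gb ?mulr0//; lia.
Qed.

(** Counting down from the degree bounds leaves only the pairs [(a - i, b - (n - i))] with
    [0 <= i <= n]. *)
Lemma coefM_dle f g a b (n : nat) : dle f a -> dle g b ->
  (f * g) (a + b - n%:Z : int) =
  \sum_(i < n.+1) f (a - i%:Z : int) * g (b - (n - i)%N%:Z : int).
Proof.
move=> fa gb; rewrite conv_coefM.
pose h (i : nat) : Zm * Zm := ((a - i%:Z : int) : Zm, (b - (n - i)%N%:Z : int) : Zm).
rewrite -(fsum_widen (P := h @` `I_n.+1)); first last.
- move=> [i j] /= ijm nij; have {ijm} : (i : int) + (j : int) = a + b - n%:Z by [].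
  have [ai _|ia] := ltP a i; first by rewrite fa ?mul0r.
  have [bj _|jb ijm] := ltP b j; first by rewrite gb ?mulr0.
  case: nij; exists (absz (a - (i : int))%R); first by rewrite /=; lia.
  by rewrite /h; congr pair; move: ia jb ijm; rewrite /Zm; lia.
- by move=> _ [i /= im <-] /=; change (a - i%:Z + (b - (n - i)%N%:Z) = a + b - n%:Z); lia.
rewrite (@fsum_reindex _ _ _ h `I_n.+1); last first.
  by split=> // i j _ _ [] ? _; lia.
by rewrite (fsbig_ord _ n.+1
  (fun i : nat => f (a - i%:Z : int) * g (b - (n - i)%N%:Z : int))).
Qed.

Lemma coefM_lead f g a b : dle f a -> dle g b ->
  (f * g) (a + b : int) = f a * g b.
Proof.
move=> fa gb; have := coefM_dle 0 fa gb.
by rewrite big_ord1 subnn !subr0.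
Qed.

Lemma coefUM (i : int) c g (m : int) :
  (convU ubounded_ideal i c * g) m = c * g (m - i : int).
Proof.
have [b gb] := dle_ex g.
have [bmi|mib] := ltP b (m - i).
  by rewrite gb// (dleM (@dleU i c) gb) ?mulr0//; lia.
rewrite [in LHS](_ : m = i + b - (absz (i + b - m)%R)%:Z); last by lia.
rewrite (coefM_dle _ (@dleU i c) gb) big_ord_recl big1 ?addr0 /=.
  by rewrite coefU_lser ifT; [congr (_ * g _); lia | lia].
by move=> j _; rewrite coefU_lser ifN ?mul0r//= /bump; lia.
Qed.

(** Finite sums of monomials approximate a series to every order; [ser_cont_eq] rests on this
    density. *)
Lemma dle_trunc f b (n : nat) : dle f b ->
  dle (f - \sum_(i < n) convU ubounded_ideal (b - i%:Z : int) (f (b - i%:Z : int)))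
      (b - n%:Z).
Proof.
move=> fb m bnm; rewrite conv_coefB conv_coef_sum.
have [bm|mb] := ltP b m.
  rewrite fb// big1 ?subr0// => i _; rewrite coefU_lser ifN//; lia.
have kn : (absz (b - m)%R < n)%N by lia.
rewrite (bigD1 (Ordinal kn))//= big1 ?addr0.
  by rewrite coefU_lser (_ : b - _ = m) ?eqxx ?subrr//; lia.
move=> [i ilt] /eqP ni; rewrite coefU_lser ifN//=; apply/eqP => im; apply: ni.
by apply: val_inj => /=; lia.
Qed.

End Degree.

Arguments dle_trunc {R f b} n _.

Section Constants.
Variable R : nzRingType.

Lemma coef_lserCM (c : R) f (m : int) : (lserC c * f) m = c * f m.
Proof. by rewrite coefUM subr0. Qed.

Lemma coef_lambdaM (f : lser R) (m : int) : (lambda * f) m = f (m - 1 : int).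
Proof. by rewrite coefUM mul1r. Qed.

Lemma lserC_is_additive : zmod_morphism (@lserC R).
Proof. by move=> a b; rewrite /lserC raddfB. Qed.

HB.instance Definition _ :=
  GRing.isZmodMorphism.Build R (lser R) (@lserC R) lserC_is_additive.

Lemma lserC_is_multiplicative : monoid_morphism (@lserC R).
Proof. by split=> // a b; rewrite /lserC convUM. Qed.

HB.instance Definition _ :=
  GRing.isMonoidMorphism.Build R (lser R) (@lserC R) lserC_is_multiplicative.

End Constants.

(** * Continuous additive maps between rings of series *)

Section Continuity.
Variables R R' : nzRingType.

(** Continuity at 0 in the [lambda^-1]-adic topology, which for additive maps is continuity
    everywhere. *)
Definition ser_cont (Phi : lser R -> lser R') :=
  forall n : nat, exists a : int, forall f, dle f a -> dle (Phi f) (- n%:Z).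

(** Subtracting monomials from [f] does not change [Phi f - Psi f], and enough of them bring [f]
    close to 0. Identities about substitution are thereby reduced to monomials. *)
Lemma ser_cont_eq (Phi Psi : lser R -> lser R') :
  zmod_morphism Phi -> zmod_morphism Psi -> ser_cont Phi -> ser_cont Psi ->
  (forall (i : int) c,
     Phi (convU ubounded_ideal i c) = Psi (convU ubounded_ideal i c)) ->
  Phi =1 Psi.
Proof.
move=> PhiB PsiB cPhi cPsi eqU f.
apply/eqP; rewrite -subr_eq0; apply/eqP/dle_eq0 => n.
have [a aP] := cPhi n; have [a' aP'] := cPsi n; have [b fb] := dle_ex f.
have eq_tr (l : nat) (F : nat -> int) (c : nat -> R) :
    Phi (f - \sum_(i < l) convU ubounded_ideal (F i) (c i)) -
    Psi (f - \sum_(i < l) convU ubounded_ideal (F i) (c i)) = Phi f - Psi f.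
  elim: l => [|l IH]; first by rewrite big_ord0 !subr0.
  rewrite big_ord_recr /= opprD addrA PhiB PsiB eqU -IH opprB.
  by rewrite addrA addrNK.
pose l := (absz (b - a)%R + absz (b - a')%R)%N.
rewrite -{eq_tr}(eq_tr l (fun i => b - i%:Z) (fun i => f (b - i%:Z : int))).
apply: dleB; [apply: aP | apply: aP'].
all: apply: (dleW _ (dle_trunc l fb)); rewrite /l; lia.
Qed.

Lemma dle_ser_cont (Phi : lser R -> lser R') (c : int) :
  (forall f a, dle f a -> dle (Phi f) (a + c)) -> ser_cont Phi.
Proof.
by move=> PhiP n; exists (- n%:Z - c) => f /PhiP; rewrite addrNK.
Qed.

End Continuity.

Lemma ser_cont_comp (R R' R'' : nzRingType) (Phi : lser R' -> lser R'')
    (Psi : lser R -> lser R') :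
  ser_cont Phi -> ser_cont Psi -> ser_cont (Phi \o Psi).
Proof.
move=> cPhi cPsi n; have [a aP] := cPhi n; have [a' aP'] := cPsi (absz a).
by exists a' => f /aP' fa; apply: aP; apply: dleW fa; lia.
Qed.

Lemma zmod_morphism_comp (U V W : zmodType) (f : V -> W) (g : U -> V) :
  zmod_morphism f -> zmod_morphism g -> zmod_morphism (f \o g).
Proof. by move=> fB gB x y /=; rewrite gB fB. Qed.

Lemma mull_zmod_morphism (R : pzRingType) (h : R) : zmod_morphism ( *%R h).
Proof. by move=> x y; rewrite mulrBr. Qed.

Lemma mulr_zmod_morphism (R : pzRingType) (h : R) : zmod_morphism ( *%R^~ h).
Proof. by move=> x y; rewrite mulrBl. Qed.

Section Mulr.
Variable R : nzRingType.

Lemma mull_ser_cont (g : lser R) : ser_cont ( *%R g).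
Proof.
have [b gb] := dle_ex g; apply: (dle_ser_cont (c := b)) => f a fa.
by rewrite addrC; exact: dleM.
Qed.

Lemma mulr_ser_cont (g : lser R) : ser_cont ( *%R^~ g).
Proof.
have [b gb] := dle_ex g; apply: (dle_ser_cont (c := b)) => f a fa.
exact: dleM.
Qed.

Lemma dleX (f : lser R) (a : int) (n : nat) : dle f a -> dle (f ^+ n) (a * n%:Z).
Proof.
move=> fa; elim: n => [|n IH]; first by rewrite mulr0; exact: dleU.
rewrite exprS (_ : a * n.+1%:Z = a + a * n%:Z); last by lia.
exact: dleM.
Qed.

End Mulr.

Arguments dleX {R f a} n _.

Section Lsum.
Variable R : nzRingType.
Implicit Types u : nat -> lser R.

Definition summable u b := forall j, dle (u j) (b - j%:Z).

Lemma lsumE u b (n : nat) (m : int) : summable u b -> b - n%:Z < m ->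
  lsum u m = \sum_(j < n) u j m.
Proof.
move=> ub bnm; rewrite /lsum mkconvE.
  rewrite (fsbig_ord _ n (fun j => u j m)); apply/esym/fsum_widen => // j _ /=.
  by move=> /negP jn; apply: ub; lia.
exists b => x /= nz; rewrite leNgt; apply/negP => bx; apply: nz.
by apply: fsbig1 => j _; apply: ub; lia.
Qed.

Lemma lsum_trunc u b (n : nat) : summable u b ->
  dle (lsum u - \sum_(j < n) u j) (b - n%:Z).
Proof.
by move=> ub m bnm; rewrite conv_coefB conv_coef_sum (lsumE ub bnm) subrr.
Qed.

Lemma dle_lsum u b : summable u b -> dle (lsum u) b.
Proof. by move=> /(@lsum_trunc u b 0); rewrite big_ord0 !subr0. Qed.

Lemma lsum_unique u b f : summable u b ->
  (forall n : nat, dle (f - \sum_(j < n) u j) (b - n%:Z)) -> f = lsum u.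
Proof.
move=> ub fu; apply/eqP; rewrite -subr_eq0; apply/eqP/dle_eq0 => n.
pose l := (absz b + n)%N; pose s := \sum_(j < l) u j.
rewrite (_ : _ - _ = (f - s) - (lsum u - s)); last by rewrite opprB addrA addrNK.
apply: dleB; first by apply: dleW (fu l); rewrite /l; lia.
by apply: dleW (@lsum_trunc u b l ub); rewrite /l; lia.
Qed.

End Lsum.

Arguments lsum_trunc {R u b} n _.

Lemma ser_cont_lsum (R R' : nzRingType) (Phi : lser R -> lser R') u b b' :
  zmod_morphism Phi -> ser_cont Phi ->
  summable u b -> summable (Phi \o u) b' -> Phi (lsum u) = lsum (Phi \o u).
Proof.
move=> PhiB cPhi ub Pub; apply: (lsum_unique Pub) => n.
(* The error after [n] terms splits into the image of the tail from [l] on, small by continuity of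
   [Phi], and the terms [n <= j < l], small because [Phi \o u] is summable. *)
have [a aP] := cPhi (absz (b' - n%:Z)%R).
pose l := (n + absz (b - a)%R)%N.
have PhiS m : Phi (lsum u) - \sum_(j < m) (Phi \o u) j
            = Phi (lsum u - \sum_(j < m) u j).
  elim: m => [|m IH]; first by rewrite !big_ord0 !subr0.
  by rewrite !big_ord_recr /= !opprD !addrA PhiB IH.
rewrite (_ : _ - _ = (Phi (lsum u) - \sum_(j < l) (Phi \o u) j)
                     + \sum_(n <= j < l) (Phi \o u) j); last first.
  rewrite -(big_mkord xpredT (Phi \o u)) -[in RHS](big_mkord xpredT (Phi \o u)).
  by rewrite (@big_cat_nat _ _ _ n 0 l) ?leq_addr//= opprD addrA addrNK.
apply: dleD.
  rewrite PhiS; apply: (dleW _ (aP _ _)); first by lia.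
  by apply: dleW (lsum_trunc l ub); rewrite /l; lia.
rewrite big_seq; apply: dle_sum => j; rewrite mem_index_iota => /andP[nj _].
by apply: dleW (Pub j); lia.
Qed.

(** * Monic series and their inverses *)

Section Monic.
Variable R : comNzRingType.
Implicit Types f g : lser R.

Definition ser_monic f a := dle f a /\ f a = 1.

Lemma ser_monic1 : ser_monic 1 0.
Proof. by split; [exact: dleU | rewrite ser_coef1]. Qed.

Lemma ser_monicM f g a b :
  ser_monic f a -> ser_monic g b -> ser_monic (f * g) (a + b).
Proof.
by move=> [fa f1] [gb g1]; split; [exact: dleM | rewrite coefM_lead// f1 g1 mulr1].
Qed.

Lemma ser_monicX f a n : ser_monic f a -> ser_monic (f ^+ n) (a * n%:Z).
Proof.
move=> fa; elim: n => [|n IH]; first by rewrite mulr0; exact: ser_monic1.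
rewrite exprS (_ : a * n.+1%:Z = a + a * n%:Z); last by lia.
exact: ser_monicM.
Qed.

Lemma ser_monicU (i : int) : ser_monic (convU ubounded_ideal i 1) i.
Proof. by split; [exact: dleU | rewrite convUE eqxx]. Qed.

(** The inverse is the geometric series in [e]: its partial sums satisfy [(1 - e) s = 1 - e^n], and
    both errors have degree at most [- n]. *)
Lemma ser_unit_sub1 (e : lser R) : dle e (-1) -> 1 - e \is a GRing.unit.
Proof.
move=> e1; have eS : summable (fun j => e ^+ j) 0.
  by move=> j; apply: dleW (dleX j e1); lia.
apply/unitrPr; exists (lsum (fun j => e ^+ j)).
apply/eqP; rewrite -subr_eq0; apply/eqP/dle_eq0 => n.
pose s := \sum_(j < n) e ^+ j.
have s1 : (1 - e) * s = 1 - e ^+ n by rewrite -opprB mulNr -subrX1 opprB.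
rewrite (_ : _ - 1 = (1 - e) * (lsum (fun j => e ^+ j) - s) - e ^+ n); last first.
  by rewrite mulrBr s1 -addrA -opprD subrK.
apply: dleB; last by apply: dleW (dleX n e1); lia.
rewrite (_ : - n%:Z = 0 + (0 - n%:Z)); last by lia.
 apply: (dleM _ (lsum_trunc n eS)).
apply: dleB; first exact: dleU.
exact: dleW e1.
Qed.

(** Dividing by the leading power gives [lambda^-a f = 1 - e] with [e] of negative degree. *)
Lemma ser_monic_unit f a : ser_monic f a -> f \is a GRing.unit.
Proof.
move=> fa; pose e := 1 - convU ubounded_ideal (- a) 1 * f.
have [ga g1] := ser_monicM (ser_monicU (- a)) fa; rewrite addNr in ga g1.
have e1 : dle e (-1).
  move=> m m1; rewrite conv_coefB ser_coef1.
  have [->|m0] := eqVneq m 0; first by rewrite g1 subrr.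
  by rewrite sub0r ga ?oppr0//; move: m0; lia.
have := ser_unit_sub1 e1; rewrite /e subKr => /unitrPr[y fy].
by apply/unitrPr; exists (convU ubounded_ideal (- a) 1 * y); rewrite mulrCA mulrA.
Qed.

Lemma ser_monicV f a : ser_monic f a -> ser_monic f^-1 (- a).
Proof.
move=> fa; have [b vb] := dle_ex f^-1; have fu := ser_monic_unit fa.
have lead c : dle f^-1 c -> (1 : lser R) (a + c : int) = f^-1 c.
  by move=> vc; rewrite -(mulrV fu) (coefM_lead fa.1 vc) fa.2 mul1r.
(* The coefficient of the inverse at a bound [- a + n.+1] equals that of 1 at the nonzero degree
   [n.+1], hence vanishes, and the bound drops by one. *)
have step (n : nat) : dle f^-1 (- a + n%:Z) -> dle f^-1 (- a).
  elim: n => [|n IH] vn; first by rewrite addr0 in vn.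
  apply: IH => m nm; have [nm'|mn] := ltP (- a + n.+1%:Z) m; first exact: vn.
  have -> : m = - a + n.+1%:Z by lia.
  by rewrite -lead// ser_coef1 ifN//; lia.
have va : dle f^-1 (- a).
  by apply: (step (absz (a + b)%R)); apply: dleW vb; lia.
by split=> //; rewrite -lead// subrr ser_coef1.
Qed.

Lemma ser_monicXz f a (i : int) : ser_monic f a -> ser_monic (f ^ i) (a * i).
Proof.
move=> fa; case: i => n; first by have := ser_monicX n fa.
by rewrite NegzE mulrN; apply/ser_monicV/ser_monicX.
Qed.

End Monic.

Lemma lambdaXz (R : comNzRingType) (i : int) :
  (lambda : lser R) ^ i = convU ubounded_ideal i 1.
Proof.
have lamX (n : nat) : (lambda : lser R) ^+ n = convU ubounded_ideal n%:Z 1.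
  elim: n => [//|n IH]; rewrite exprS IH convUM mulr1; congr convU.
case: i => n; first exact: lamX.
have u := ser_monic_unit (ser_monicU R n.+1%:Z).
rewrite NegzE -exprnN lamX; apply: (mulrI u); rewrite divrr// convUM mulr1.
congr convU; change (0 = n.+1%:Z - n.+1%:Z :> int); lia.
Qed.

(** * The derivation [delta = lambda d/dlambda] *)

Section Euler.
Variable R : nzRingType.
Implicit Types f g : lser R.

Definition ser_euler f : lser R :=
  mkconv ubounded_ideal (fun m : Zm => f m *~ (m : int)).

Lemma ser_eulerE f (m : int) : ser_euler f m = f m *~ m.
Proof.
have [b fb] := dle_ex f; rewrite /ser_euler mkconvE//; exists b => {}m /= nz.
by rewrite leNgt; apply/negP => bm; apply: nz; rewrite fb ?mul0rz.
Qed.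

Lemma ser_euler_is_additive : zmod_morphism ser_euler.
Proof.
move=> f g; apply/convP => m; rewrite conv_coefB !ser_eulerE conv_coefB.
by rewrite mulrzBl.
Qed.

HB.instance Definition _ :=
  GRing.isZmodMorphism.Build (lser R) (lser R) ser_euler ser_euler_is_additive.

Lemma dle_euler f a : dle f a -> dle (ser_euler f) a.
Proof. by move=> fa m am; rewrite ser_eulerE fa ?mul0rz. Qed.

Lemma ser_euler_cont : ser_cont ser_euler.
Proof. by apply: (dle_ser_cont (c := 0)) => f a; rewrite addr0; exact: dle_euler. Qed.

Lemma ser_eulerU (i : int) c :
  ser_euler (convU ubounded_ideal i c) = convU ubounded_ideal i (c *~ i).
Proof.
apply/convP => m; rewrite ser_eulerE !convUE.
by case: eqP => [->|]; rewrite ?mul0rz.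
Qed.

Lemma ser_eulerM f g : ser_euler (f * g) = ser_euler f * g + f * ser_euler g.
Proof.
have [a fa] := dle_ex f; have [b gb] := dle_ex g.
apply/convP => m; rewrite ser_eulerE conv_coefD.
have [abm|mab] := ltP (a + b) m.
  by rewrite !(dleM _ _ abm) ?mul0rz ?addr0//; exact: dle_euler.
have -> : m = (a + b - (absz (a + b - m)%R)%:Z : int) :> Zm by rewrite /Zm; lia.
rewrite (coefM_dle _ fa gb) (coefM_dle _ (dle_euler fa) gb).
rewrite (coefM_dle _ fa (dle_euler gb)) -big_split mulrz_suml /=.
apply: eq_bigr => i _; rewrite !ser_eulerE mulrzAl mulrzAr -mulrzDr.
by congr (_ *~ _); have := ltn_ord i; lia.
Qed.

End Euler.

Lemma map_euler (R R' : nzRingType) (phi : {additive R -> R'}) f :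
  map_conv phi (ser_euler f) = ser_euler (map_conv phi f).
Proof.
apply/convP => m; rewrite ser_eulerE !map_convE ?raddf0//.
by rewrite ser_eulerE raddfMz.
Qed.

Section EulerPower.
Variable R : comNzRingType.
Implicit Types f g : lser R.

Lemma ser_eulerX f n : ser_euler (f ^+ n) = f ^+ n.-1 * ser_euler f *+ n.
Proof.
elim: n => [|n IH]; first by rewrite expr0 mulr0n (ser_eulerU 0 1) mulr0z raddf0.
rewrite exprS ser_eulerM IH mulrnAr mulrA -exprS [ser_euler f * _]mulrC mulrS.
by case: n {IH} => [|n]; rewrite ?mulr0n.
Qed.

(** The factor [f] on both sides avoids the exponent [n - 1], so that the same form holds for
    negative exponents in [ser_eulerXz]. *)
Lemma mulr_eulerX f n : f * ser_euler (f ^+ n) = f ^+ n * ser_euler f *+ n.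
Proof.
by rewrite ser_eulerX mulrnAr mulrA -exprS; case: n.
Qed.

Lemma ser_eulerXz f a (i : int) : ser_monic f a ->
  f * ser_euler (f ^ i) = f ^ i * ser_euler f *~ i.
Proof.
move=> fa; have fu := ser_monic_unit fa.
case: i => n; first exact: mulr_eulerX.
have fnu : f ^+ n.+1 \is a GRing.unit by rewrite unitrX.
have fVf : f ^- n.+1 * f ^+ n.+1 = 1 by rewrite mulVr.
(* For a negative exponent, [delta] is applied to [f ^- n.+1 * f ^+ n.+1 = 1]. *)
rewrite NegzE -exprnN; have := congr1 (fun g => f * ser_euler g) fVf.
rewrite (ser_eulerU 0 1) mulr0z raddf0 mulr0 ser_eulerM mulrDr.
rewrite [f * (f ^- _ * _)]mulrCA mulr_eulerX => /eqP; rewrite addr_eq0 => /eqP eu.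
apply: (mulIr fnu); rewrite -mulrA eu mulrnAr mulrA fVf mul1r.
by rewrite mulrNz mulNr mulrzAl mulrAC fVf mul1r.
Qed.

End EulerPower.

(** * Substitution and compositional inverses *)

Section Lcomp.
Variable R : comNzRingType.
Variables (P : lser R) (N : nat).
Hypothesis monP : ser_monic P N.+1%:Z.
Implicit Types f g : lser R.

(** Since [P ^ i] has degree [N.+1 * i], only finitely many exponents contribute to a given power of
    [lambda]: at most [b] because of [f], more than [b - n] because of [P]. *)
Lemma lcompE f b (n : nat) (m : int) : dle f b -> (b - n%:Z) * N.+1%:Z < m ->
  lcomp f P m = \sum_(j < n) f (b - j%:Z : int) * (P ^ (b - j%:Z)) m.
Proof.
move=> fb bnm.
have P0 (i m' : int) : N.+1%:Z * i < m' -> (P ^ i) m' = 0.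
  exact: (ser_monicXz i monP).1.
rewrite /lcomp /lsum mkconvE; last first.
  exists (N.+1%:Z * b) => x /= nz; rewrite leNgt; apply/negP => bx; apply: nz.
  apply: fsbig1 => i _; rewrite coef_lserCM.
  have [/fb ->|ib] := ltP b i; first by rewrite mul0r.
  rewrite P0 ?mulr0//; apply: le_lt_trans bx.
  by rewrite ler_pM2l.
pose h (j : nat) := b - j%:Z.
rewrite -(fsum_widen (P := h @` `I_n)) //; last first.
  move=> i _ nij; rewrite coef_lserCM.
  have [/fb ->|ib] := ltP b i; first by rewrite mul0r.
  rewrite P0 ?mulr0//; apply: le_lt_trans bnm.
  rewrite mulrC ler_pM2r// leNgt; apply/negP => bni; apply: nij.
  by exists (absz (b - i)%R); rewrite /h /=; lia.
rewrite (@fsum_reindex _ _ _ h `I_n).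
  rewrite (fsbig_ord _ n (fun j : nat => f (h j) * (P ^ h j) m)).
  by apply: eq_fsum => j _; rewrite coef_lserCM.
by split=> // i j _ _; rewrite /h; lia.
Qed.

Lemma dle_lcomp f b : dle f b -> dle (lcomp f P) (b * N.+1%:Z).
Proof.
by move=> fb m bm; rewrite (lcompE (n := 0) fb) ?subr0// big_ord0.
Qed.

Lemma lcomp_cont : ser_cont ((@lcomp R)^~ P).
Proof.
move=> n; exists (- n%:Z) => f /dle_lcomp; apply: dleW.
by rewrite mulNr lerN2; nia.
Qed.

Lemma lcomp_is_additive : zmod_morphism ((@lcomp R)^~ P).
Proof.
move=> f g; have [b fb] := dle_ex f; have [c gc] := dle_ex g.
have bM : dle f (Num.max b c) by apply: dleW fb; rewrite le_max lexx.
have cM : dle g (Num.max b c) by apply: dleW gc; rewrite le_max lexx orbT.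
apply/convP => m; rewrite conv_coefB.
pose n := (absz (Num.max b c) + absz (m : int)).+1.
have nP : (Num.max b c - n%:Z) * N.+1%:Z < (m : int).
  rewrite /n; move: (Num.max b c) (m : int) => B M; nia.
rewrite !(lcompE _ nP)//; last exact: dleB.
rewrite -sumrB; apply: eq_bigr => j _.
by rewrite conv_coefB mulrBl.
Qed.

Lemma lcompU (i : int) c :
  lcomp (convU ubounded_ideal i c) P = lserC c * P ^ i.
Proof.
apply/convP => m; rewrite coef_lserCM.
pose n := (absz i + absz (m : int)).+1.
have nP : (i - n%:Z) * N.+1%:Z < (m : int).
  by rewrite /n; move: (m : int) => M; nia.
rewrite (lcompE (@dleU _ i c) nP) big_ord_recl big1 ?addr0 /=.
  by rewrite coefU_lser eqxx.
by move=> j _; rewrite coefU_lser ifN ?mul0r//= /bump; lia.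
Qed.

Lemma lcomp1 : lcomp 1 P = 1.
Proof. by rewrite (lcompU 0 1) mulr1. Qed.

Lemma lcomp_lambda : lcomp lambda P = P.
Proof. by rewrite (lcompU 1 1) mul1r. Qed.

(** Both sides are additive and continuous in [g], then in [f]; on monomials the claim is the law of
    exponents for the unit [P]. *)
Lemma lcompM f g : lcomp (f * g) P = lcomp f P * lcomp g P.
Proof.
have lB := lcomp_is_additive; have lC := lcomp_cont.
apply: (ser_cont_eq (Phi := (@lcomp R)^~ P \o *%R f)
          (Psi := *%R (lcomp f P) \o (@lcomp R)^~ P)) => [||||i c /=].
- exact: zmod_morphism_comp lB (mull_zmod_morphism _).
- exact: zmod_morphism_comp (mull_zmod_morphism _) lB.
- exact: ser_cont_comp lC (mull_ser_cont f).
- exact: ser_cont_comp (mull_ser_cont _) lC.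
apply: (ser_cont_eq (Phi := (@lcomp R)^~ P \o *%R^~ (convU ubounded_ideal i c))
  (Psi := *%R^~ (lcomp (convU ubounded_ideal i c) P) \o (@lcomp R)^~ P)) => [||||j d /=].
- exact: zmod_morphism_comp lB (mulr_zmod_morphism _).
- exact: zmod_morphism_comp (mulr_zmod_morphism _) lB.
- exact: ser_cont_comp lC (mulr_ser_cont _).
- exact: ser_cont_comp (mulr_ser_cont _) lC.
rewrite convUM !lcompU /lserC mulrACA convUM -exprzDr ?(ser_monic_unit monP)//.
Qed.

End Lcomp.

Section MapSer.
Variables (R R' : nzRingType) (phi : {additive R -> R'}).

Lemma dle_map (f : lser R) a : dle f a -> dle (map_conv phi f) a.
Proof. by move=> fa m am; rewrite map_convE ?raddf0// fa ?raddf0. Qed.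

Lemma map_lser_cont : ser_cont (map_conv (S := ubounded_ideal) phi).
Proof. by apply: (dle_ser_cont (c := 0)) => f a; rewrite addr0; exact: dle_map. Qed.

End MapSer.

Lemma ser_monic_map (R R' : comNzRingType) (phi : {rmorphism R -> R'}) f a :
  ser_monic f a -> ser_monic (map_conv phi f) a.
Proof.
by move=> [fa f1]; split; [exact: dle_map | rewrite map_convE ?rmorph0// f1 rmorph1].
Qed.

(** With [pi] the constant term in [xi] and [eta], taking constant terms commutes with the
    substitution of a series free of [xi] and [eta]. *)
Lemma map_lcomp_scal (R R' R'' : comNzRingType) (phi : {rmorphism R -> R'})
    (pi : {additive R' -> R''}) (psi : {rmorphism R -> R''}) N P f :
  (forall x y, pi (y * phi x) = pi y * psi x) -> ser_monic P N.+1%:Z ->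
  map_conv pi (lcomp f (map_conv phi P)) = lcomp (map_conv pi f) (map_conv psi P).
Proof.
move=> piM monP.
have monP1 := ser_monic_map phi monP; have monP2 := ser_monic_map psi monP.
apply: (ser_cont_eq (Phi := map_conv (S := ubounded_ideal) pi
                              \o (@lcomp R')^~ (map_conv phi P))
  (Psi := (@lcomp R'')^~ (map_conv psi P) \o map_conv (S := ubounded_ideal) pi))
  => [||||i c /=].
- exact: zmod_morphism_comp (raddfB _) (lcomp_is_additive monP1).
- exact: zmod_morphism_comp (lcomp_is_additive monP2) (raddfB _).
- exact: ser_cont_comp (map_lser_cont pi) (lcomp_cont monP1).
- exact: ser_cont_comp (lcomp_cont monP2) (map_lser_cont pi).
rewrite map_convU (lcompU monP1) (lcompU monP2).
rewrite -!rmorphXz ?(ser_monic_unit monP)//=.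
apply/convP => m; rewrite map_convE ?raddf0// !coef_lserCM.
by rewrite !map_convE ?raddf0// piM.
Qed.

Lemma map_lcomp (R R' : comNzRingType) (phi : {rmorphism R -> R'}) N P f :
  ser_monic P N.+1%:Z ->
  map_conv phi (lcomp f P) = lcomp (map_conv phi f) (map_conv phi P).
Proof.
move=> monP; have := map_lcomp_scal (phi := idfun) (pi := phi) (psi := phi) f _ monP.
by rewrite map_conv_id; apply=> x y; exact: (rmorphM phi).
Qed.

Section LcompTheory.
Variable R : comNzRingType.
Variables (P : lser R) (N : nat).
Hypothesis monP : ser_monic P N.+1%:Z.
Implicit Types f g : lser R.

Lemma lcompXz f a (i : int) : ser_monic f a ->
  lcomp (f ^ i) P = lcomp f P ^ i.
Proof.
move=> fa; have fu := ser_monic_unit fa.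
have X g (n : nat) : lcomp (g ^+ n) P = lcomp g P ^+ n.
  elim: n => [|n IH]; first by rewrite !expr0 (lcomp1 monP).
  by rewrite !exprS (lcompM monP) IH.
case: i => n; first exact: X.
have e : lcomp (f ^- n.+1) P * lcomp f P ^+ n.+1 = 1.
  by rewrite -X -(lcompM monP) mulVr ?unitrX// (lcomp1 monP).
have u : lcomp f P ^+ n.+1 \is a GRing.unit.
  by apply/unitrPr; exists (lcomp (f ^- n.+1) P); rewrite mulrC.
by rewrite NegzE -!exprnN; apply: (mulIr u); rewrite e mulVr.
Qed.

Lemma ser_monic_lcomp f a : ser_monic f a -> ser_monic (lcomp f P) (a * N.+1%:Z).
Proof.
move=> [fa f1]; split; first exact: dle_lcomp.
rewrite (lcompE monP (n := 1) fa); last by lia.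
by rewrite big_ord1 subr0 f1 mul1r mulrC (ser_monicXz _ monP).2.
Qed.

Lemma lcompC c : lcomp (lserC c) P = lserC c.
Proof. by rewrite /lserC (lcompU monP) mulr1. Qed.

Lemma lcomp_lcomp F G M : ser_monic G M.+1%:Z ->
  lcomp (lcomp F G) P = lcomp F (lcomp G P).
Proof.
move=> monG; have lB := lcomp_is_additive monP; have lC := lcomp_cont monP.
have monGP : ser_monic (lcomp G P) (M.+1 * N.+1).-1.+1%:Z.
  rewrite prednK ?muln_gt0// PoszM; exact: ser_monic_lcomp.
apply: (ser_cont_eq (Phi := (@lcomp R)^~ P \o (@lcomp R)^~ G)
  (Psi := (@lcomp R)^~ (lcomp G P))) => [||||i c /=].
- exact: zmod_morphism_comp lB (lcomp_is_additive monG).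
- exact: lcomp_is_additive monGP.
- exact: ser_cont_comp lC (lcomp_cont monG).
- exact: lcomp_cont monGP.
by rewrite (lcompU monG) (lcompU monGP) (lcompM monP) lcompC (lcompXz i monG).
Qed.

(** The chain rule, multiplied by [P]; on the monomial [u^i] it is
    [P delta(P^i) = i P^i delta P]. *)
Lemma euler_lcomp f :
  P * ser_euler (lcomp f P) = lcomp (ser_euler f) P * ser_euler P.
Proof.
have lB := lcomp_is_additive monP; have lC := lcomp_cont monP.
apply: (ser_cont_eq (Phi := *%R P \o (@ser_euler R \o (@lcomp R)^~ P))
  (Psi := *%R^~ (ser_euler P) \o ((@lcomp R)^~ P \o @ser_euler R))) => [||||i c /=].
- apply: zmod_morphism_comp (mull_zmod_morphism _) _.
  exact: zmod_morphism_comp (raddfB _) lB.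
- apply: zmod_morphism_comp (mulr_zmod_morphism _) _.
  exact: zmod_morphism_comp lB (raddfB _).
- apply: ser_cont_comp (mull_ser_cont _) _.
  exact: ser_cont_comp (@ser_euler_cont R) lC.
- apply: ser_cont_comp (mulr_ser_cont _) _.
  exact: ser_cont_comp lC (@ser_euler_cont R).
rewrite ser_eulerU !(lcompU monP) ser_eulerM /lserC ser_eulerU mulr0z raddf0.
rewrite mul0r add0r mulrCA (ser_eulerXz _ monP) -mulrzAr mulrA raddfMz.
by rewrite mulrzAr !mulrzAl.
Qed.

End LcompTheory.

(** * Uniqueness for the equation [delta f = f h] *)

Section Uniqueness.
Variable R : comNzRingType.
Hypothesis intR : forall (m : int) (x : R), m != 0 -> x *~ m = 0 -> x = 0.
Implicit Types f g h : lser R.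

(** If [f] has degree at most [N - j], comparing coefficients there gives [(N - j) c = N c], hence
    [- j c = 0]. This says nothing for [j = 0], which is why the coefficient at [N] is
    prescribed. *)
Lemma euler_eq0 f h (N : nat) : dle h 0 -> h (0 : int) = N%:R -> dle f N%:Z ->
  f (N%:Z : int) = 0 -> ser_euler f = f * h -> f = 0.
Proof.
move=> h0 hN fN fN0 fh; apply: dle_eq0 => n.
suff dN (j : nat) : dle f (N%:Z - j%:Z) by apply: dleW (dN (N + n)%N); lia.
elim: j => [|j IH] m jm; first by apply: fN; lia.
have [/IH//|mj] := ltP (N%:Z - j%:Z) m.
have {jm mj} -> : m = N%:Z - j%:Z by lia.
have [->|jN] := eqVneq j 0%N; first by rewrite subr0.
apply: (intR (m := - j%:Z)); first by lia.
have := congr1 (fun g : lser R => g (N%:Z - j%:Z : int)) fh.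
have lead := coefM_lead IH h0; rewrite addr0 in lead.
rewrite /= ser_eulerE lead hN mulrzBr.
by rewrite mulr_natr mulrNz => /eqP; rewrite -subr_eq0 addrAC subrr sub0r => /eqP.
Qed.

Lemma euler_unique f g h (N : nat) : dle h 0 -> h (0 : int) = N%:R ->
  ser_monic f N%:Z -> ser_monic g N%:Z ->
  ser_euler f = f * h -> ser_euler g = g * h -> f = g.
Proof.
move=> h0 hN [fN f1] [gN g1] fh gh; apply/eqP; rewrite -subr_eq0; apply/eqP.
apply: (euler_eq0 h0 hN); first exact: dleB.
  by rewrite conv_coefB f1 g1 subrr.
by rewrite raddfB /= fh gh mulrBl.
Qed.

End Uniqueness.

Section CompInverse.
Variable R : comNzRingType.
Variable G : lser R.
Hypothesis monG : ser_monic G 1.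

(* The coefficients of [compinv G] at [u^1, u^0, u^(-1), ...], each one read off
   the triangular system [\sum_i F_i G^i = lambda]. *)
Fixpoint compinv_seq (n : nat) : seq R :=
  if n is m.+1 then
    let s := compinv_seq m in
    rcons s ((m == 0%N)%:R - \sum_(i < m) s`_i * (G ^ (1 - i%:Z)) (1 - m%:Z : int))
  else [::].

Lemma size_compinv_seq n : size (compinv_seq n) = n.
Proof. by elim: n => //= n IH; rewrite size_rcons IH. Qed.

Lemma nth_compinv_seq n i : (i < n)%N -> (compinv_seq n)`_i = (compinv_seq i.+1)`_i.
Proof.
elim: n => // n IH; rewrite ltnS leq_eqVlt => /orP[/eqP->//|lt_in].
by rewrite [in LHS]/= nth_rcons size_compinv_seq lt_in IH.
Qed.

Lemma is_compinv_ex : exists F, is_compinv G F.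
Proof.
pose c j := (compinv_seq j.+1)`_j.
pose u (j : nat) : lser R := convU ubounded_ideal (1 - j%:Z : int) (c j).
have su : summable u 1 by move=> j; exact: dleU.
pose F := lsum u.
have FE (j : nat) : F (1 - j%:Z : int) = c j.
  rewrite (lsumE (n := j.+1) su); last by lia.
  rewrite big_ord_recr big1 /= ?add0r; first by rewrite coefU_lser eqxx.
  by move=> [i ilt] _ /=; rewrite coefU_lser ifN//; lia.
have c0 : c 0%N = 1 by rewrite /c /= big_ord0 subr0.
have F1 : dle F 1 := dle_lsum su.
exists F; split=> [||//]; first by have := FE 0%N; rewrite subr0 c0.
  by [].
apply/convP => m; rewrite coefU_lser.
have [lt1m|le_m1] := ltP (1 : int) m.
  by rewrite (dle_lcomp (N := 0) monG F1)// ifN//; move: lt1m; rewrite /Zm; lia.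
have [j ->] : exists j : nat, m = (1 - j%:Z : int) :> Zm.
  by exists (absz (1 - (m : int))%R); rewrite /Zm; lia.
rewrite (lcompE (N := 0) (n := j.+1) monG F1); last by lia.
(* The term [i = j] carries the leading coefficient 1 of [G ^ (1 - j)], so the last entry of
   [compinv_seq j.+1] cancels the earlier terms and leaves the coefficient of [lambda] at
   [1 - j]. *)
rewrite big_ord_recr /= FE /c /= nth_rcons size_compinv_seq ltnn eqxx.
have := (ser_monicXz (1 - j%:Z) monG).2; rewrite mul1r => ->; rewrite mulr1.
rewrite (eq_bigr (fun i : 'I_j => (compinv_seq j)`_i * (G ^ (1 - i%:Z)) (1 - j%:Z : int))).
  rewrite addrC subrK; case: j => [|j] //=; rewrite ifN//; lia.
by move=> i _; rewrite FE /c -(nth_compinv_seq (ltn_ord i)).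
Qed.

(** Since a solution exists, the choice made by [xget] does not fall back on 0. *)
Lemma compinvP : is_compinv G (compinv G).
Proof. by rewrite /compinv; have /(xgetPex 0) := is_compinv_ex. Qed.

End CompInverse.

(** * The logarithmic derivative of [G_q] *)

Section InvSeries.
Variable R : nzRingType.

Definition inv_series (c : nat -> R) : lser R :=
  mkconv ubounded_ideal (fun m : Zm => if (m : int) <= 0 then c (absz (m : int)) else 0).

Lemma inv_seriesE c (m : int) :
  inv_series c m = if m <= 0 then c (absz m) else 0.
Proof.
rewrite /inv_series mkconvE//; exists 0 => {}m /= nz.
by rewrite leNgt; apply/negP => m0; apply: nz; rewrite leNgt m0.
Qed.

Lemma dle_inv_series c : dle (inv_series c) 0.
Proof. by move=> m m0; rewrite inv_seriesE leNgt m0. Qed.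

Lemma coef_inv_series c (j : nat) : inv_series c (- j%:Z : int) = c j.
Proof. by rewrite inv_seriesE abszN absz_nat ifT//; lia. Qed.

End InvSeries.

Lemma map_inv_series (R R' : nzRingType) (phi : {additive R -> R'}) c :
  map_conv phi (inv_series c) = inv_series (phi \o c).
Proof.
apply/convP => m; rewrite map_convE ?raddf0// !inv_seriesE.
by case: ifP; rewrite ?raddf0.
Qed.

(** * Division by integers *)

Section NatUnits.

Lemma conv_natr_unit (R : unitRingType) (G : monoidType) (S : support_ideal G)
    (n : nat) : n%:R \is a @GRing.unit R -> n%:R \is a @GRing.unit (conv R S).
Proof.
move=> nu; rewrite (@conv_natr R G S n); apply/unitrP; exists (convU S 1%g n%:R^-1).
split; first by rewrite convUM mulg1 mulVr.
by rewrite convUM mulg1 mulrV.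
Qed.

Lemma natr_unit_torsion (R : unitRingType) (n : nat) (x : R) :
  n%:R \is a @GRing.unit R -> x *+ n = 0 -> x = 0.
Proof. by move=> nu; rewrite -mulr_natr => xn0; rewrite -(mulrK nu x) xn0 mul0r. Qed.

Lemma natr_unit_inj (R : unitRingType) (n : nat) (x y : R) :
  n%:R \is a @GRing.unit R -> x *+ n = y *+ n -> x = y.
Proof. by move=> nu; rewrite -[x *+ n]mulr_natr -[y *+ n]mulr_natr; exact: (mulIr nu). Qed.

Lemma divr_natK (R : unitRingType) (n : nat) (x : R) :
  n%:R \is a @GRing.unit R -> x / n%:R *+ n = x.
Proof. by move=> nu; rewrite -[x / _ *+ n]mulr_natr divrK. Qed.

Lemma dle_div (R : unitRingType) (f : lser R) a n :
  n%:R \is a @GRing.unit R -> dle f a -> dle (f / n%:R) a.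
Proof.
move=> nu fa m am; apply: (natr_unit_torsion nu).
by rewrite -conv_coefMn divr_natK ?fa//; exact: conv_natr_unit.
Qed.

End NatUnits.

Lemma lsum_behead (R : nzRingType) (u : nat -> lser R) b : summable u b ->
  u 0%N = 0 -> lsum u = lsum (fun j => u j.+1).
Proof.
move=> ub u0; apply/convP => m.
have ub' : summable (fun j => u j.+1) b by move=> j; apply: dleW (ub j.+1); lia.
pose n := (absz (b - (m : int))%R).+1.
have bnm : b - n%:Z < (m : int) by rewrite /n; move: (m : int) => M; lia.
have bnm' : b - n.+1%:Z < (m : int) by move: bnm; move: (m : int) => M; lia.
by rewrite (lsumE ub bnm') (lsumE ub' bnm) big_ord_recl u0 conv_coef0 add0r.
Qed.

Section Exponential.
Variable R : comUnitRingType.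
Hypothesis natR : forall n : nat, (0 < n)%N -> n%:R \is a @GRing.unit R.
Variable f : lser R.
Hypothesis f1 : dle f (-1).

Let u (m : nat) : lser R := f ^+ m / (m`!)%:R.

Let su : summable u 0.
Proof.
move=> j; apply: dle_div; first by rewrite natR ?fact_gt0.
by apply: dleW (dleX j f1); lia.
Qed.

Lemma ser_monic_lexp : ser_monic (lexp f) 0.
Proof.
split; first exact: (dle_lsum su).
rewrite (lsumE (n := 1) su); last by lia.
by rewrite big_ord1 /u expr0 fact0 divr1 ser_coef1.
Qed.

(** Term by term, [delta(f^(j+1) / (j+1)!) = (f^j / j!) delta f], while the term of index 0 is a
    constant and drops out. *)
Lemma euler_lexp : ser_euler (lexp f) = lexp f * ser_euler f.
Proof.
have natS n : (0 < n)%N -> n%:R \is a @GRing.unit (lser R).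
  by move=> n0; apply: conv_natr_unit; exact: natR.
have eu j : ser_euler (u j.+1) = u j * ser_euler f.
  apply: (natr_unit_inj (natS _ (fact_gt0 j.+1))).
  rewrite -raddfMn divr_natK ?natS ?fact_gt0//.
  rewrite /= ser_eulerX -pred_Sn [in RHS]factS [in RHS]mulnC [in RHS]mulrnA.
  by rewrite -[in RHS]mulrnAl divr_natK ?natS ?fact_gt0.
have s1 : summable (@ser_euler R \o u) 0 by move=> j; exact: dle_euler.
have s2 : summable ( *%R^~ (ser_euler f) \o u) 0.
  by move=> j /=; have := dleM (@su j) (dle_euler f1); apply: dleW; lia.
rewrite /lexp (ser_cont_lsum (raddfB _) (@ser_euler_cont R) su s1).
rewrite (ser_cont_lsum (mulr_zmod_morphism (ser_euler f)) (mulr_ser_cont _) su s2).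
rewrite (lsum_behead s1); last first.
  by rewrite /= /u expr0 fact0 divr1 (ser_eulerU 0 1) mulr0z raddf0.
by congr lsum; apply/funext => j; exact: eu.
Qed.

End Exponential.

Lemma lambda_inv (R : nzRingType) : (lambda : lser R)^-1 = convU ubounded_ideal (-1 : int) 1.
Proof.
have VL : convU ubounded_ideal (-1 : int) 1 * lambda = 1 :> lser R.
  by rewrite convUM mulr1.
have LV : lambda * convU ubounded_ideal (-1 : int) 1 = 1 :> lser R.
  by rewrite convUM mulr1.
have lu : (lambda : lser R) \is a GRing.unit.
  by apply/unitrP; exists (convU ubounded_ideal (-1 : int) 1).
by apply: (mulrI lu); rewrite mulrV// LV.
Qed.

Section Gq.
Variable k : fieldType.
Hypothesis chark : [pchar k] =i pred0.

Lemma natr_unit_pchar0 (n : nat) : (0 < n)%N -> n%:R \is a @GRing.unit k.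
Proof. by move=> n0; rewrite unitfE ((pcharf0P k).1 chark) -lt0n. Qed.

Lemma CoeffE i j (a : qtorus k) (c : int) : Coeff i j a c = a (c, i, j).
Proof.
rewrite /Coeff mkconvE//.
apply: (sub_finite_set _ (finite_image (fun g : heis => g.1.1) (conv_small a))).
by move=> {}c /= nz; exists (c : int, i, j).
Qed.

Lemma Coeff_is_additive i j : zmod_morphism (@Coeff k i j).
Proof.
by move=> a b; apply/convP => c; rewrite conv_coefB !CoeffE conv_coefB.
Qed.

HB.instance Definition _ i j :=
  GRing.isZmodMorphism.Build (qtorus k) (laurent k) (Coeff i j)
    (Coeff_is_additive i j).

Lemma Coeff1 : Coeff 0 0 (1 : qtorus k) = 1.
Proof.
apply/convP => c; rewrite CoeffE !conv_coef1.
by congr (if _ then _ else _); apply/eqP/eqP => [[->]|->].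
Qed.

Definition W : qtorus k := xA k + yA k - (xA k)^-1 * (yA k)^-1.

Lemma D_W : D k = lambda - lserC W.
Proof. by rewrite /D /W rmorphB rmorphD /= !opprD opprK !addrA. Qed.

Definition Cser : lser (laurent k) := inv_series (fun m => Coeff 0 0 (W ^+ m)).

Let L := llog (lambda^-1 * D k).
Let u (m : nat) : lser (qtorus k) :=
  (-1) ^+ m * (lambda^-1 * D k - 1) ^+ m.+1 / m.+1%:R.

Let natQ (n : nat) : (0 < n)%N -> n%:R \is a @GRing.unit (qtorus k).
Proof. by move=> n0; apply: conv_natr_unit; exact: natr_unit_pchar0. Qed.

(** As [lambda^-1 D - 1 = - lambda^-1 W], the signs combine to -1, and each term of the logarithm
    lives in a single power of [lambda]. *)
Let uE m : u m *+ m.+1 = - convU ubounded_ideal (- m.+1%:Z : int) (W ^+ m.+1).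
Proof.
rewrite divr_natK; last by apply: conv_natr_unit; exact: natQ.
have -> : lambda^-1 * D k - 1 = - convU ubounded_ideal (-1 : int) W.
  by rewrite D_W lambda_inv mulrBr !convUM !mul1r addrAC subrr sub0r.
rewrite (exprNn (convU _ _ W)) mulrA -exprD addnS exprS -signr_odd addnn odd_double mulr1 mulN1r.
congr (- _); elim: m.+1 => [//|n IH].
by rewrite !exprS IH convUM; congr convU; change (-1 - n%:Z = - n.+1%:Z); lia.
Qed.

Let u0 m (j : int) : j != - m.+1%:Z -> u m j = 0.
Proof.
move=> jm; apply: (@natr_unit_torsion (qtorus k) m.+1 (u m j) (natQ (ltn0Sn m))).
by rewrite -conv_coefMn uE conv_coefN coefU_lser (negPf jm) oppr0.
Qed.

Let su : summable u (-1).
Proof. by move=> m j jm; apply: u0; lia. Qed.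

Let LE m : L (- m.+1%:Z : int) *+ m.+1 = - W ^+ m.+1.
Proof.
rewrite (lsumE (n := m.+1) su); last by lia.
rewrite big_ord_recr big1 /=; last by move=> [i im] _; apply: u0 => /=; lia.
by rewrite add0r -conv_coefMn uE conv_coefN coefU_lser eqxx.
Qed.

Let ell := map_conv (@Coeff k 0 0) L.

Let ell1 : dle ell (-1). Proof. exact/dle_map/(dle_lsum su). Qed.

Let natL (n : nat) : (0 < n)%N -> n%:R \is a @GRing.unit (laurent k).
Proof. by move=> n0; apply: conv_natr_unit; exact: natr_unit_pchar0. Qed.

Lemma ser_monic_Gq : ser_monic (Gq k) 1.
Proof. exact: ser_monicM (ser_monicU _ 1) (ser_monic_lexp natL ell1). Qed.

(** At [lambda^-m], [delta] multiplies by [- m], which cancels the [-1/m] of the logarithm and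
    leaves [c_m(q)]; the factor [lambda] of [G_q] supplies the term [c_0 = 1]. *)
Lemma euler_Gq : ser_euler (Gq k) = Gq k * Cser.
Proof.
rewrite /Gq -/L -/ell ser_eulerM (euler_lexp natL ell1) ser_eulerU mulr1z.
rewrite mulrA -[X in X + _]mulr1 -mulrDr; congr (_ * _).
apply/convP => m; rewrite conv_coefD ser_coef1 ser_eulerE inv_seriesE.
rewrite map_convE ?raddf0//.
have [m0|m0|->] := ltrgtP (m : int) 0; last first.
- by rewrite mulr0z addr0 expr0 Coeff1.
- by rewrite (dle_lsum su) ?raddf0 ?mul0rz ?addr0//; move: (m : int) m0 => M; lia.
have [j ->] : exists j : nat, m = (- j.+1%:Z : int) :> Zm.
  by exists (absz (m : int)).-1; move: m0; rewrite /Zm; lia.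
rewrite add0r mulrNz -pmulrn -raddfMn LE raddfN opprK.
by rewrite abszN.
Qed.

End Gq.

(** * Newton's identities *)

Section DetDerivation.
Variables (R : comNzRingType) (d : {additive R -> R}).
Hypothesis dM : forall x y, d (x * y) = d x * y + x * d y.

Lemma derivation_prod (I : finType) (F : I -> R) :
  d (\prod_i F i) = \sum_i \prod_j (if j == i then d (F j) else F j).
Proof.
have d1 : d 1 = 0.
  by have := dM 1 1; rewrite !mulr1 mul1r -[LHS]addr0 => /addrI/esym.
have key (r : seq I) : uniq r ->
    d (\prod_(i <- r) F i)
    = \sum_(i <- r) \prod_(j <- r) (if j == i then d (F j) else F j).
  elim: r => [|i r IH] /=; first by rewrite !big_nil.
  move=> /andP[ir ur]; rewrite !big_cons dM (IH ur) eqxx; congr (_ * _ + _).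
    rewrite big_seq [RHS]big_seq; apply: eq_bigr => j jr.
    by rewrite ifN//; apply: contraNneq ir => <-.
  rewrite mulr_sumr big_seq [RHS]big_seq; apply: eq_bigr => l lr.
  by rewrite big_cons ifN//; apply: contraNneq ir => ->.
by have := key (index_enum I) (index_enum_uniq I).
Qed.

(** Jacobi's formula: by the Leibniz rule one row is differentiated at a time, and each resulting
    determinant is expanded along that row. *)
Lemma derivation_det n (M : 'M[R]_n) :
  d (\det M) = \sum_i \sum_j d (M i j) * cofactor M i j.
Proof.
pose M' i : 'M[R]_n := \matrix_(l, j) (if l == i then d (M l j) else M l j).
transitivity (\sum_i \det (M' i)).
  rewrite /determinant raddf_sum exchange_big /=; apply: eq_bigr => s _.
  rewrite mulr_sign [in LHS](fun_if d) raddfN derivation_prod -mulr_sign /=.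
  rewrite mulr_sumr; apply: eq_bigr => i _; congr (_ * _).
  by apply: eq_bigr => j _; rewrite mxE.
apply: eq_bigr => i _; rewrite (expand_det_row _ i); apply: eq_bigr => j _.
rewrite mxE eqxx; congr (_ * (_ * \det _)).
by apply/matrixP => a b; rewrite !mxE eq_sym (negPf (neq_lift _ _)).
Qed.

End DetDerivation.

Section CharPoly.
Variables (R : comNzRingType) (n : nat) (A : 'M[R]_n.+1).

Definition char_ser_mx : 'M[lser R]_n.+1 :=
  \matrix_(i, j) (lambda *+ (i == j) - lserC (A i j)).

Definition trace_ser : lser R := inv_series (fun m => \tr (A ^+ m)).

(** The expansion of [lambda (lambda - A)^-1]. *)
Definition resolvent : 'M[lser R]_n.+1 :=
  \matrix_(i, j) inv_series (fun m => (A ^+ m) i j).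

Lemma mul_char_ser_mx : char_ser_mx *m resolvent = lambda%:M.
Proof.
apply/matrixP => i j; apply/convP => m; rewrite !mxE.
transitivity ((lambda * resolvent i j - \sum_l lserC (A i l) * resolvent l j) m).
  congr (coef _ _); rewrite -(eq_bigr _ (fun l _ => erefl)).
  under eq_bigr do rewrite mxE mulrBl.
  rewrite sumrB; congr (_ - _); rewrite (bigD1 i)//= eqxx big1 ?addr0//.
  by move=> l li; rewrite eq_sym (negPf li) mul0r.
rewrite conv_coefB conv_coef_sum coef_lambdaM mxE inv_seriesE.
have [m1|m1] := ltP 1 (m : int).
  rewrite ifN; last by move: m1; move: (m : int) => M; lia.
  rewrite big1 ?subr0.
    case: eqP => _; last by [].
    by rewrite mulr1n coefU_lser ifN//; move: m1; move: (m : int) => M; lia.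
  move=> l _; rewrite coef_lserCM mxE inv_seriesE ifN ?mulr0//.
  by move: m1; move: (m : int) => M; lia.
rewrite ifT; last by move: m1; move: (m : int) => M; lia.
have [->|m0] := eqVneq (m : int) 1.
  rewrite subrr expr0 mxE big1 ?subr0.
    by case: eqP; rewrite ?mulr1n ?mulr0n// coefU_lser eqxx.
  by move=> l _; rewrite coef_lserCM mxE inv_seriesE mulr0.
have [l ->] : exists l : nat, m = (- l%:Z : int) :> Zm.
  exists (absz (m : int)); move: m0 m1; rewrite /Zm; lia.
rewrite (_ : absz _ = l.+1); last by lia.
rewrite (_ : (lambda *+ (i == j)) _ = 0); last first.
  case: eqP => _; last by [].
  by rewrite mulr1n coefU_lser ifN//; lia.
apply/eqP; rewrite subr_eq0; apply/eqP; rewrite exprS mxE; apply: eq_bigr => a _.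
by rewrite coef_lserCM mxE coef_inv_series.
Qed.

(** As [delta] maps [lambda - A] to [lambda] times the identity, Jacobi's formula gives [lambda]
    times the trace of the adjugate, which [mul_char_ser_mx] turns into the determinant times
    [\tr resolvent]. *)
Lemma euler_char_ser : ser_euler (\det char_ser_mx) = \det char_ser_mx * trace_ser.
Proof.
rewrite (derivation_det (@ser_eulerM R)) /=.
have adjE : \adj char_ser_mx *m lambda%:M = \det char_ser_mx *: resolvent.
  by rewrite -mul_char_ser_mx mulmxA mul_adj_mx mul_scalar_mx.
have -> : trace_ser = \tr resolvent.
  apply/convP => m; rewrite /mxtrace conv_coef_sum inv_seriesE.
  under [RHS]eq_bigr do rewrite mxE inv_seriesE.
  by case: ifP => // _; rewrite big1.
rewrite -mxtraceZ -adjE mul_mx_scalar mxtraceZ mulr_sumr; apply: eq_bigr => i _.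
rewrite (bigD1 i)//= big1 ?addr0 => [|j ji]; rewrite !mxE.
  by rewrite eqxx raddfB /= !ser_eulerU !mulr0z raddf0 subr0 mulr1z.
rewrite eq_sym (negPf ji) sub0r raddfN /= ser_eulerU mulr0z !raddf0 mul0r //.
Qed.

Lemma coef_char_ser (m : int) :
  (\det char_ser_mx) m = if 0 <= m then (char_poly A)`_(absz m) else 0.
Proof.
pose ev : {rmorphism {poly R} -> lser R} := horner_eval (lambda : lser R) \o map_poly (@lserC R).
have -> : char_ser_mx = map_mx ev (char_poly_mx A).
  apply/matrixP => i j; rewrite !mxE rmorphB rmorphMn /= map_polyX map_polyC /=.
  by rewrite /horner_eval hornerX hornerC.
rewrite det_map_mx -/(char_poly A) /= /horner_eval horner_coef conv_coef_sum.
have lamX (i : nat) (c : R) (l : int) :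
    (lserC c * lambda ^+ i) l = if l == i%:Z then c else 0.
  rewrite coef_lserCM (_ : lambda ^+ i = convU ubounded_ideal i%:Z 1).
    by rewrite coefU_lser; case: ifP; rewrite ?mulr1 ?mulr0.
  exact: (lambdaXz R i%:Z).
under eq_bigr do rewrite coef_map lamX.
case: m => m /=; last by rewrite big1.
have sz := size_map_poly_id0 (f := @lserC R) (p := char_poly A).
have [lt_m|le_m] := ltnP m (size (map_poly (@lserC R) (char_poly A))).
  rewrite (bigD1 (Ordinal lt_m))//= eqxx big1 ?addr0// => i im.
  rewrite ifN//; apply: contraNneq im => -[mi]; exact/eqP/val_inj.
rewrite big1.
  have := congr1 (fun f : lser R => f (0 : int)) (nth_default 0 le_m).
  by rewrite coef_map /= /lserC convUE eqxx.
by move=> [i ilt] _ /=; rewrite ifN//; apply: contraTneq ilt => -[<-]; rewrite -leqNgt.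
Qed.

Lemma ser_monic_char : ser_monic (\det char_ser_mx) n.+1%:Z.
Proof.
split=> [m nm|]; rewrite coef_char_ser.
  rewrite ifT; last by lia.
  by rewrite nth_default// size_char_poly; lia.
by have := char_poly_monic A; rewrite monicE lead_coefE size_char_poly => /eqP.
Qed.

Lemma coef_char_ser_neg (m : int) : m < 0 -> (\det char_ser_mx) m = 0.
Proof. by rewrite coef_char_ser leNgt => ->. Qed.

(** Newton's identities, read off from [euler_char_ser] at [lambda^(n.+1 - m)]. *)
Lemma char_ser_newton (m : nat) :
  (\det char_ser_mx) (n.+1%:Z - m%:Z : int) *~ (- m%:Z)
  = \sum_(i < m) (\det char_ser_mx) (n.+1%:Z - i%:Z : int) * \tr (A ^+ (m - i)).
Proof.
have eq := congr1 (fun f : lser R => f (n.+1%:Z - m%:Z : int)) euler_char_ser.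
have prod := coefM_dle m ser_monic_char.1 (dle_inv_series (fun m => \tr (A ^+ m))).
rewrite /= ser_eulerE -[in X in _ = X](addr0 n.+1%:Z) prod big_ord_recr /= in eq.
(* The term [i = m] contains [\tr (A ^+ 0) = n.+1]; moving it to the left changes the factor
   [n.+1 - m] into [- m]. *)
rewrite [X in _ *~ X](_ : - m%:Z = n.+1%:Z - m%:Z - n.+1%:Z); last by lia.
rewrite mulrzBr {}eq subnn subr0 (coef_inv_series _ 0) expr0 mxtrace1 mulr_natr addrK.
by apply: eq_bigr => i _; rewrite sub0r coef_inv_series.
Qed.

End CharPoly.

(** * The representation [rho] *)

Section AlgLift.
Variables (R : nzRingType) (G : monoidType).
Local Notation alg := (conv R (finite_ideal G)).

Lemma conv_fin_decomp (a : alg) :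
  a = \sum_(g <- fset_set (supp a)) convU (finite_ideal G) g (a g).
Proof.
have fin := conv_small a; apply/convP => x; rewrite conv_coef_sum.
have [ax|/eqP ax] := eqVneq (a x) 0.
  rewrite ax big1 // => g _; rewrite convUE; case: eqP => // xg.
  by rewrite -xg.
rewrite (big_rem x) /=; last by rewrite in_fset_set// inE.
rewrite convUE eqxx big_seq big1 ?addr0// => g.
rewrite mem_rem_uniq ?fset_uniq// inE => /andP[gx _].
by rewrite convUE eq_sym (negPf gx).
Qed.

Lemma conv_fin_ext (V : zmodType) (Phi Psi : alg -> V) :
  zmod_morphism Phi -> zmod_morphism Psi ->
  (forall g r, Phi (convU _ g r) = Psi (convU _ g r)) -> Phi =1 Psi.
Proof.
move=> PhiB PsiB eqU a.
pose PhiA := GRing.isZmodMorphism.Build alg V Phi PhiB.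
pose PsiA := GRing.isZmodMorphism.Build alg V Psi PsiB.
pose PhiF : {additive alg -> V} := HB.pack Phi PhiA.
pose PsiF : {additive alg -> V} := HB.pack Psi PsiA.
rewrite (conv_fin_decomp a) -[Phi _]/(PhiF _) -[Psi _]/(PsiF _) !raddf_sum.
by apply: eq_bigr => g _; exact: eqU.
Qed.

Variables (B : nzRingType) (F : G -> R -> B).
Hypothesis FB : forall g, zmod_morphism (F g).

(** Common form of [eval1], [modPhi], [rho] and [psi]: additive extension from monomials,
    multiplicative as soon as it is so on monomials. *)
Definition alg_lift (a : alg) : B := \sum_(g \in [set: G]) F g (a g).

Let F0 g : F g 0 = 0.
Proof. by rewrite -(subrr 0) FB subrr. Qed.

Lemma alg_liftU g r : alg_lift (convU _ g r) = F g r.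
Proof.
rewrite /alg_lift -(fsum_widen (P := [set g]))//.
  by rewrite fsbig_set1 convUE eqxx.
by move=> h _ hg; rewrite convUE; case: eqP => // hg'; case: hg.
Qed.

Lemma alg_lift_is_additive : zmod_morphism alg_lift.
Proof.
have fin (a : alg) (H : G -> R -> B) : (forall g, H g 0 = 0) ->
    finite_set ([set: G] `&` (fun g => H g (a g)) @^-1` [set~ 0]).
  move=> H0; apply: sub_finite_set (conv_small a) => g [_] /=.
  by apply: contra_not => /= ->.
move=> a b; apply/eqP; rewrite eq_sym subr_eq; apply/eqP.
rewrite /alg_lift -fsum_split; [|exact: fin|exact: fin].
by apply: eq_fsum => g _; rewrite conv_coefB FB subrK.
Qed.

Hypothesis F1 : F 1%g 1 = 1.
Hypothesis FM : forall g h r s, F g r * F h s = F (g * h)%g (r * s).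

Lemma alg_lift_is_multiplicative : monoid_morphism alg_lift.
Proof.
split; first by rewrite alg_liftU.
move=> a b; have lB := alg_lift_is_additive.
apply: (conv_fin_ext (Phi := alg_lift \o *%R^~ b)
          (Psi := *%R^~ (alg_lift b) \o alg_lift)) => [||g r /=].
- exact: zmod_morphism_comp lB (mulr_zmod_morphism _).
- exact: zmod_morphism_comp (mulr_zmod_morphism _) lB.
apply: (conv_fin_ext (Phi := alg_lift \o *%R (convU (finite_ideal G) g r))
  (Psi := *%R (alg_lift (convU (finite_ideal G) g r)) \o alg_lift)) => [||h s /=].
- exact: zmod_morphism_comp lB (mull_zmod_morphism _).
- exact: zmod_morphism_comp (mull_zmod_morphism _) lB.
by rewrite convUM !alg_liftU FM.
Qed.

End AlgLift.

Section Eval1.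
Variable k : nzRingType.

Lemma eval1_is_additive : zmod_morphism (@eval1 k).
Proof. exact: (@alg_lift_is_additive k Zm k (fun _ r => r)). Qed.

Lemma eval1_is_multiplicative : monoid_morphism (@eval1 k).
Proof. exact: (@alg_lift_is_multiplicative k Zm k (fun _ r => r)). Qed.

HB.instance Definition _ :=
  GRing.isZmodMorphism.Build (laurent k) k (@eval1 k) eval1_is_additive.
HB.instance Definition _ :=
  GRing.isMonoidMorphism.Build (laurent k) k (@eval1 k) eval1_is_multiplicative.

Lemma eval1U c (r : k) : eval1 (convU (finite_ideal Zm) c r) = r.
Proof. exact: (@alg_liftU k Zm k (fun _ r => r)). Qed.

Lemma laurentC_is_additive : zmod_morphism (@laurentC k).
Proof. by move=> a b; rewrite /laurentC raddfB. Qed.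

HB.instance Definition _ :=
  GRing.isZmodMorphism.Build k (laurent k) (@laurentC k) laurentC_is_additive.

Lemma laurentC_is_multiplicative : monoid_morphism (@laurentC k).
Proof. by split=> // a b; rewrite /laurentC convUM. Qed.

HB.instance Definition _ :=
  GRing.isMonoidMorphism.Build k (laurent k) (@laurentC k) laurentC_is_multiplicative.

End Eval1.

(** The inverses are supplied by [u (- j)]; this computes all integer powers of [rho_x] and
    [rho_y]. *)
Lemma exprz_hom (B : unitRingType) (u : int -> B) (i : int) :
  u 0 = 1 -> (forall i j, u (i + j) = u i * u j) -> u 1 ^ i = u i.
Proof.
move=> u0 uD.
have uX (m : nat) : u 1 ^+ m = u m%:Z.
  by elim: m => [|m IH]; rewrite ?u0// exprS IH -uD; congr u; lia.
have uu j : u j \is a GRing.unit.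
  by apply/unitrP; exists (u (- j)); rewrite -!uD addNr subrr u0.
case: i => m; first exact: uX.
by rewrite NegzE -exprnN uX; apply: (mulrI (uu m.+1%:Z)); rewrite mulrV// -uD subrr.
Qed.

(** * The class of [q] as a root of unity *)

Section RootOfUnity.
Variables (k : fieldType) (n : nat).
Hypothesis chark : [pchar k] =i pred0.
Local Notation N := n.+1.
Local Notation Kz := (Kzeta k n).
Local Notation z := (zeta k n).
Local Notation iota := (@qpolyC k (Phi k n)).

Lemma iota_natr_unit m : (0 < m)%N -> m%:R \is a @GRing.unit Kz.
Proof.
move=> m0; have mu := natr_unit_pchar0 chark m0.
have := rmorph_unit iota mu; by rewrite rmorph_nat.
Qed.

Lemma zeta_dvd (m : int) : (N %| m)%Z -> z ^ m = 1.
Proof. by move=> /dvdzP[q ->]; rewrite mulrC -exprz_exp -[z ^ N]/(z ^+ N) zetaX exp1rz. Qed.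

(** [Phi_N] may factor over [k], so [Kzeta] need not be a field and units must be exhibited.
    Separability of [X^N - 1] makes [Phi_N] coprime to each [Phi_d] with [d] dividing [e], hence to
    [X^e - 1]; Bezout gives the inverse. *)
Lemma zeta_sub1_unit e : (0 < e < N)%N -> (e %| N)%N -> z ^+ e - 1 \is a GRing.unit.
Proof.
move=> /andP[e0 eN] edN.
have sep : separable_poly ('X^N - 1 : {poly k}).
  by rewrite separable_Xn_sub_1// -unitfE (natr_unit_pchar0 chark).
have prodE (m : nat) : (0 < m)%N ->
    'X^m - 1 = \prod_(d <- divisors m) map_poly intr 'Phi_d :> {poly k}.
  move=> m0; have := congr1 (map_poly (intr : int -> k)) (prod_Cyclotomic m0).
  by rewrite rmorphB /= map_polyXn rmorph1 rmorph_prod.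
have cop d : d \in divisors e -> coprimep (Phi k n) (map_poly intr 'Phi_d).
  move=> de; move: sep; rewrite prodE// (big_rem N) /=; last by rewrite divisors_id.
  rewrite (big_rem d) /=.
    by rewrite separable_mul coprimepMr => /and3P[_ _ /andP[]].
  move: de; rewrite -dvdn_divisors// => de.
  rewrite mem_rem_uniq ?divisors_uniq// inE -dvdn_divisors// (dvdn_trans de edN) andbT.
  by apply: contraTneq (dvdn_leq e0 de) => ->; rewrite -ltnNge.
have {cop} : coprimep (Phi k n) ('X^e - 1).
  rewrite prodE// big_seq; elim/big_ind: _ => [|p q pc qc|d /cop//].
    exact: coprimep1.
  by rewrite coprimepMr pc.
rewrite coprimep_sym => /Bezout_eq1_coprimepP[[u v] /= uv].
apply/unitrPr; exists (in_qpoly (Phi k n) u).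
have Phi0 : in_qpoly (Phi k n) (Phi k n) = 0.
  apply: val_inj; rewrite /= mk_monic_Phi Pdiv.RingMonic.rmodpp //.
  by have := monic_mk_monic (Phi k n); rewrite mk_monic_Phi.
have -> : z ^+ e - 1 = in_qpoly (Phi k n) ('X^e - 1).
  by rewrite rmorphB rmorphXn rmorph1.
have := congr1 (in_qpoly (Phi k n)) uv.
by rewrite rmorphD !rmorphM rmorph1 /= Phi0 mulr0 addr0 mulrC.
Qed.

Lemma sum_zeta (j : int) :
  \sum_(b < N) z ^ (b%:Z * j) = if (N %| j)%Z then N%:R else 0.
Proof.
case: ifPn => [Nj|Nj].
  under eq_bigr do rewrite zeta_dvd ?dvdz_mull//.
  by rewrite sumr_const card_ord.
pose m := absz (j %% N)%Z.
have jE : j = (j %/ N)%Z * N + m%:Z.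
  by rewrite {1}(divz_eq j N) /m gez0_abs// modz_ge0.
have m0 : (0 < m)%N.
  by rewrite lt0n; apply: contraNneq Nj => m0; rewrite jE m0 addr0 dvdz_mull.
have mN : (m < N)%N by rewrite /m -ltz_nat gez0_abs ?modz_ge0// ltz_pmod.
have zE (b : nat) : z ^ (b%:Z * j) = (z ^+ m) ^+ b.
  rewrite -exprM mulnC {1}jE mulrDr exprzDr ?zeta_unit// zeta_dvd ?mul1r.
    by rewrite -PoszM.
  by rewrite mulrA dvdz_mull.
under eq_bigr do rewrite zE.
set s := \sum_(b < N) _.
(* From [(z^m - 1) s = 0] one passes to [e = gcd(m, N)], a proper divisor of [N]: [z^e] is a power
   of [z^m], so the unit [z^e - 1] is a multiple of [z^m - 1] and also kills [s]. *)
have s0 : (z ^+ m - 1) * s = 0.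
  by rewrite -subrX1 -exprM mulnC exprM zetaX expr1n subrr.
have e0 : (0 < gcdn m N)%N by rewrite gcdn_gt0 m0.
have eN : (gcdn m N < N)%N by apply: leq_ltn_trans mN; apply: dvdn_leq => //; exact: dvdn_gcdl.
have u := zeta_sub1_unit (e := gcdn m N) _ (dvdn_gcdr _ _).
apply: (mulrI (u _)); first by rewrite e0.
rewrite mulr0; case: (egcdnP N m0) => km kn kmE _.
have -> : z ^+ gcdn m N = (z ^+ m) ^+ km.
  by rewrite -exprM mulnC kmE exprD mulnC exprM zetaX expr1n mul1r.
by rewrite subrX1 mulrAC s0 mul0r.
Qed.

(** The power of [q] produced by reordering [(x^-1 y^-1)^N]. For [N] even, [z^(N/2) = -1] because
    [z^(N/2) - 1] is a unit, and ['C(N, 2)] is an odd multiple of [N/2]; for [N] odd, [N] divides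
    ['C(N, 2)]. *)
Lemma zeta_binom : z ^+ 'C(N, 2) = (-1) ^+ n.
Proof.
rewrite bin2 /=; have [nodd|neven] := boolP (odd n).
  have nE : N = (n./2.+1).*2 by rewrite -{1}(odd_double_half n) nodd.
  rewrite {1}nE -doubleMl doubleK.
  have hu := zeta_sub1_unit (e := n./2.+1).
  have zh : z ^+ n./2.+1 = -1.
    apply/eqP; rewrite -subr_eq0 opprK; apply/eqP.
    apply: (mulrI (hu _ _)); first by rewrite nE -addnn; lia.
      by rewrite nE -muln2 dvdn_mulr.
    by rewrite mulr0 -subr_sqr_1 -exprM muln2 -nE zetaX subrr.
  by rewrite exprM zh.
have -> : ((N * n)./2 = N * n./2)%N.
  by rewrite -{2}[n]odd_double_half (negPf neven) add0n -doubleMr doubleK.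
rewrite exprM zetaX.
by rewrite expr1n -signr_odd (negPf neven).
Qed.

Lemma modPhi_is_additive : zmod_morphism (@modPhi k n).
Proof.
apply: (@alg_lift_is_additive k Zm Kz (fun c r => iota r * z ^ (c : int))) => c a b.
by rewrite rmorphB mulrBl.
Qed.

Lemma modPhi_is_multiplicative : monoid_morphism (@modPhi k n).
Proof.
apply: (@alg_lift_is_multiplicative k Zm Kz (fun c r => iota r * z ^ (c : int))).
- by move=> c a b; rewrite rmorphB mulrBl.
- by rewrite rmorph1 mul1r.
move=> c d r s; rewrite rmorphM mulrACA -exprzDr ?zeta_unit//.
Qed.

End RootOfUnity.

HB.instance Definition _ (k : fieldType) (n : nat) :=
  GRing.isZmodMorphism.Build (laurent k) (Kzeta k n) (@modPhi k n)
    (@modPhi_is_additive k n).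
HB.instance Definition _ (k : fieldType) (n : nat) :=
  GRing.isMonoidMorphism.Build (laurent k) (Kzeta k n) (@modPhi k n)
    (@modPhi_is_multiplicative k n).

Lemma modPhiU (k : fieldType) n (c : int) (r : k) :
  modPhi n (convU (finite_ideal Zm) c r) = qpolyC (Phi k n) r * zeta k n ^ c.
Proof.
apply: (@alg_liftU k Zm (Kzeta k n) (fun c r => qpolyC (Phi k n) r * zeta k n ^ (c : int))).
by move=> d a b; rewrite rmorphB mulrBl.
Qed.

(** * Matrices and traces of monomials under [rho] *)

Section Rho.
Variables (k : fieldType) (n : nat).
Local Notation N := n.+1.
Local Notation Kz := (Kzeta k n).
Local Notation Kx := (Kxe k n).
Local Notation z := (zeta k n).
Local Notation iota := (@qpolyC k (Phi k n)).

Definition mon (i j : int) (c : Kz) : Kx :=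
  convU (finite_ideal (Zm * Zm)%type) ((i, j) : int * int) c.

Lemma mon_is_additive i j : zmod_morphism (mon i j).
Proof. by move=> a b; rewrite /mon raddfB. Qed.

HB.instance Definition _ i j :=
  GRing.isZmodMorphism.Build Kz Kx (mon i j) (mon_is_additive i j).

Lemma monM i j i' j' c c' : mon i j c * mon i' j' c' = mon (i + i') (j + j') (c * c').
Proof. by rewrite /mon convUM. Qed.

Lemma monE i j c (i' j' : int) :
  mon i j c ((i', j') : int * int) = if (i' == i) && (j' == j) then c else 0.
Proof. by rewrite /mon convUE. Qed.

Lemma mon00 c : mon 0 0 c = scalC c. Proof. by []. Qed.

Lemma scalC_is_additive : zmod_morphism (@scalC k n).
Proof. exact: mon_is_additive. Qed.

Lemma scalC_is_multiplicative : monoid_morphism (@scalC k n).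
Proof. by split=> // a b; rewrite scalCM. Qed.

HB.instance Definition _ :=
  GRing.isZmodMorphism.Build Kz Kx (@scalC k n) scalC_is_additive.
HB.instance Definition _ :=
  GRing.isMonoidMorphism.Build Kz Kx (@scalC k n) scalC_is_multiplicative.

Lemma mon_exprz i j (l : int) : mon i j 1 ^ l = mon (i * l) (j * l) 1.
Proof.
have := exprz_hom (u := fun l => mon (i * l) (j * l) 1) l; rewrite !mulr1; apply.
  by rewrite !mulr0.
by move=> a b; rewrite monM mulr1 !mulrDr.
Qed.

Lemma dvdz_ord_eq (a b : 'I_N) : (N %| a%:Z - b%:Z)%Z = (a == b).
Proof.
apply/idP/eqP => [|->]; last by rewrite subrr dvdz0.
move=> /dvdzP[q qE]; apply/val_inj => /=; apply/eqP; rewrite -eqz_nat -subr_eq0.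
have la := ltn_ord a; have lb := ltn_ord b.
have [q0|q0] := eqVneq q 0; first by rewrite qE q0 mul0r.
by move: qE q0; nia.
Qed.

Lemma ord_shift (b : 'I_N) (i : int) : exists l : 'I_N, (N %| l%:Z - b%:Z - i)%Z.
Proof.
pose r := ((b%:Z + i) %% N)%Z.
have r0 : 0 <= r by rewrite modz_ge0.
have rN : r < N by rewrite ltz_pmod.
have lN : (absz r < N)%N by rewrite -ltz_nat gez0_abs.
exists (Ordinal lN); rewrite /= gez0_abs//; apply/dvdzP.
exists (- ((b%:Z + i) %/ N)%Z); have := divz_eq (b%:Z + i) N; rewrite -/r; lia.
Qed.

Lemma dvdz_sub_shift (a l b : 'I_N) (i : int) : (N %| l%:Z - b%:Z - i)%Z ->
  (N %| a%:Z - b%:Z - i)%Z = (a == l).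
Proof.
move=> lb; rewrite -dvdz_ord_eq (_ : a%:Z - b%:Z - i = a%:Z - l%:Z + (l%:Z - b%:Z - i)).
  by rewrite rpredDr.
lia.
Qed.

(** The matrix of [x^i], given uniformly for both signs of [i] by a congruence modulo [N]. *)
Definition shift_mx (i : int) : 'M[Kx]_N :=
  \matrix_(a, b) (if (N %| a%:Z - b%:Z - i)%Z then mon i 0 1 else 0).

Lemma shift_mxD i j : shift_mx (i + j) = shift_mx i * shift_mx j.
Proof.
apply/matrixP => a b; rewrite !mxE; have [l lP] := ord_shift b j.
rewrite (bigD1 l)//= big1 ?addr0 => [|c cl]; rewrite !mxE.
  rewrite lP (_ : a%:Z - b%:Z - (i + j) = (a%:Z - l%:Z - i) + (l%:Z - b%:Z - j)).
    rewrite rpredDr//; case: ifP; rewrite ?mul0r// monM mulr1 addr0 //.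
  lia.
by rewrite (dvdz_sub_shift _ lP) (negPf cl) mulr0.
Qed.

Lemma rho_xE (i : int) : rho_x k n ^ i = shift_mx i.
Proof.
have -> : rho_x k n = shift_mx 1.
  apply/matrixP => a b; rewrite !mxE (@dvdz_sub_shift a (ordS b)) //=.
  apply/dvdzP; exists (- (b.+1 %/ N)%N%:Z); have := divn_eq b.+1 N; lia.
apply: exprz_hom; last exact: shift_mxD.
apply/matrixP => a b; rewrite !mxE subr0 dvdz_ord_eq mon00 rmorph1.
by case: eqP.
Qed.

Definition phase_mx (j : int) : 'M[Kx]_N :=
  diag_mx (\row_b mon 0 j (z ^ (b%:Z * j))).

Lemma rho_yE (j : int) : rho_y k n ^ j = phase_mx j.
Proof.
have -> : rho_y k n = phase_mx 1.
  congr diag_mx; apply/matrixP => a b; rewrite !mxE mulr1 /=.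
  by rewrite -mon00 /Eta -[convU _ _ 1]/(mon 0 1 1) monM mulr1.
apply: exprz_hom => [|i j'].
  apply/matrixP => a b; rewrite !mxE mulr0 expr0z mon00 rmorph1.
  by case: eqP.
rewrite /phase_mx -[RHS]/(_ *m _) mulmx_diag; congr diag_mx.
apply/matrixP => a b; rewrite !mxE monM addr0 mulrDr exprzDr ?zeta_unit//.
Qed.

Definition rho_gen (g : heis) (r : k) : 'M[Kx]_N :=
  (scalC (iota r * z ^ g.1.1))%:M * rho_x k n ^ g.1.2 * rho_y k n ^ g.2.

Definition rho_entry c i j (r : k) (a b : 'I_N) : Kx :=
  if (N %| a%:Z - b%:Z - i)%Z then mon i j (iota r * z ^ (c + b%:Z * j)) else 0.

Lemma rho_genE c i j r : rho_gen (c, i, j) r = \matrix_(a, b) rho_entry c i j r a b.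
Proof.
rewrite /rho_gen rho_xE rho_yE -!mulmxE mul_scalar_mx -scalemxAl mul_mx_diag.
apply/matrixP => a b; rewrite !mxE /rho_entry.
case: ifP; rewrite ?mul0r ?mulr0// monM -mon00 monM !mul1r !add0r addr0.
by rewrite -mulrA -exprzDr ?zeta_unit.
Qed.

Lemma rho_gen_is_additive g : zmod_morphism (rho_gen g).
Proof.
by move=> r s; rewrite /rho_gen rmorphB mulrBl !raddfB /= !mulrBl.
Qed.

Lemma rho_genM g h r s : rho_gen g r * rho_gen h s = rho_gen (g * h)%g (r * s).
Proof.
case: g h => [[c i] j] [[c' i'] j']; 
change (rho_gen (c, i, j) r * rho_gen (c', i', j') s
        = rho_gen (c + c' + j * i', i + i', j + j') (r * s)).
rewrite !rho_genE.
apply/matrixP => a b; rewrite !mxE; have [l lP] := ord_shift b i'.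
rewrite (bigD1 l)//= big1 ?addr0 => [|d dl]; rewrite !mxE /rho_entry.
  rewrite lP (_ : a%:Z - b%:Z - (i + i') = (a%:Z - l%:Z - i) + (l%:Z - b%:Z - i')).
    rewrite (rpredDr _ lP); case: ifP => [_|_]; last by rewrite mul0r.
    rewrite monM rmorphM mulrACA; congr (mon _ _ _).
    rewrite -(exprzDr (zeta_unit k n)); congr (_ * _); have [q qE] := dvdzP lP.
    (* The exponents differ by [(l - b - i') j], a multiple of [N]; the term [j * i'] comes from
       [y^j x^i' = q^(j i') x^i' y^j]. *)
    have -> : c + l%:Z * j + (c' + b%:Z * j')
            = (l%:Z - b%:Z - i') * j + (c + c' + j * i' + b%:Z * (j + j')) by ring.
    by rewrite exprzDr ?zeta_unit// zeta_dvd ?mul1r// dvdz_mulr.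
  lia.
by rewrite (dvdz_sub_shift _ lP) (negPf dl) mulr0.
Qed.

Lemma rho_is_additive : zmod_morphism (@rho k n).
Proof. exact: (alg_lift_is_additive rho_gen_is_additive). Qed.

Lemma rho_is_multiplicative : monoid_morphism (@rho k n).
Proof.
apply: (alg_lift_is_multiplicative rho_gen_is_additive _ rho_genM).
by rewrite /rho_gen /= !expr0z rmorph1 !mul1r.
Qed.

HB.instance Definition _ :=
  GRing.isZmodMorphism.Build (qtorus k) 'M[Kx]_N (@rho k n) rho_is_additive.
HB.instance Definition _ :=
  GRing.isMonoidMorphism.Build (qtorus k) 'M[Kx]_N (@rho k n) rho_is_multiplicative.

Lemma rhoU g (r : k) : rho n (convU (finite_ideal heis) g r) = rho_gen g r.
Proof. exact: (alg_liftU rho_gen_is_additive). Qed.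

Hypothesis chark : [pchar k] =i pred0.

(** On a monomial [x^i y^j] the diagonal vanishes unless [N] divides [i], and then the trace is a
    multiple of the sum of [z^(b j)] over [b], evaluated by [sum_zeta]. *)
Lemma trace_rho (a : qtorus k) (i j : int) :
  (\tr (rho n a)) ((i, j) : int * int) =
  if (N %| i)%Z && (N %| j)%Z then modPhi n (Coeff i j a) *+ N else 0.
Proof.
move: a; apply: conv_fin_ext => [a b|a b|[[c i'] j'] r].
- by rewrite !raddfB /= conv_coefB.
- by case: ifP; rewrite ?subr0// !raddfB /= mulrnBl.
rewrite rhoU rho_genE /mxtrace.
have -> : \sum_(b < N) (\matrix_(a, b) rho_entry c i' j' r a b) b b =
    if (N %| i')%Z && (N %| j')%Z then mon i' j' (iota r * z ^ c) *+ N else 0.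
  under eq_bigr do rewrite mxE /rho_entry subrr sub0r rpredN.
  case: (boolP (N %| i')%Z) => /= _; last by rewrite big1.
  rewrite -raddf_sum /=.
  under eq_bigr do rewrite exprzDr ?zeta_unit// mulrA.
  rewrite -mulr_sumr sum_zeta//; case: ifP => _; last by rewrite mulr0 raddf0.
  by rewrite mulr_natr raddfMn.
have -> : Coeff i j (convU (finite_ideal heis) (c, i', j') r) =
    if (i == i') && (j == j') then convU (finite_ideal Zm) c r else 0.
  apply/convP => c''; rewrite CoeffE convUE -[_ == _]/((c'' == c) && (i == i') && (j == j')).
  rewrite -andbA; case: (_ && (j == j')) => /=; last by rewrite andbF.
  by rewrite andbT convUE.
have [->|ii'] := eqVneq i i'; last first.
  rewrite !raddf0 mul0rn if_same; case: ifP => // _.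
  by rewrite conv_coefMn monE (negPf ii') mul0rn.
have [->|jj'] := eqVneq j j'; last first.
  rewrite !raddf0 mul0rn if_same; case: ifP => // _.
  by rewrite conv_coefMn monE (negPf jj') andbF mul0rn.
case: ifP => // _; by rewrite conv_coefMn monE !eqxx modPhiU.
Qed.

End Rho.

(** * The determinant *)

Section PowersOfW.
Variable k : fieldType.

Lemma coef_qmonM c0 i0 j0 (b : qtorus k) (c i j : int) :
  (qmon k c0 i0 j0 * b) ((c, i, j) : heis)
  = b ((c - c0 - j0 * (i - i0), i - i0, j - j0) : heis).
Proof.
rewrite conv_coefM.
rewrite -(fsum_widen (P := [set ((c0, i0, j0) : heis,
                                 (c - c0 - j0 * (i - i0), i - i0, j - j0) : heis)])).
- by rewrite fsbig_set1 convUE eqxx mul1r.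
- by move=> _ -> /=; congr (_, _, _); ring.
move=> [g [[c' i'] j']] /= gx ng; rewrite convUE; case: eqP => [g0|_]; last first.
  by rewrite mul0r.
case: ng; move: gx; rewrite g0 => -[<- <- <-].
by congr (_, (_, _, _)); ring.
Qed.

Lemma W_qmon : W k = qmon k 0 1 0 + qmon k 0 0 1 - qmon k 0 (-1) (-1).
Proof.
have invE (g h : qtorus k) : g * h = 1 -> h * g = 1 -> g^-1 = h.
  move=> gh hg; have gu : g \is a GRing.unit by apply/unitrP; exists h.
  by apply: (mulrI gu); rewrite gh mulrV.
rewrite /W (invE (xA k) (qmon k 0 (-1) 0)) ?(invE (yA k) (qmon k 0 0 (-1)));
  rewrite /xA /yA qmonM //; congr (_ - qmon k _ _ _).
Qed.

Lemma coef_WM (b : qtorus k) (c i j : int) :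
  (W k * b) ((c, i, j) : heis) = b ((c, i - 1, j) : heis)
    + b ((c - i, i, j - 1) : heis) - b ((c + i + 1, i + 1, j + 1) : heis).
Proof.
rewrite W_qmon mulrBl mulrDl conv_coefB conv_coefD !coef_qmonM.
by congr (b (_, _, _) + b (_, _, _) - b (_, _, _)); ring.
Qed.

(* The Newton polygon of [W ^+ l] is [l] times the triangle with vertices
   (1, 0), (0, 1), (-1, -1). *)
Lemma coef_WX_out l (c i j : int) :
  (l%:Z < i + j) || (l%:Z < j - 2 * i) || (l%:Z < i - 2 * j) ->
  (W k ^+ l) ((c, i, j) : heis) = 0.
Proof.
elim: l c i j => [|l IH] c i j out.
  rewrite expr0 conv_coef1; case: eqP => // -[_ i0 j0].
  by move: out; rewrite i0 j0; lia.
by rewrite exprS coef_WM !IH ?addr0 ?subr0//; lia.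
Qed.

(** Besides its vertices, the triangle contains only the origin as a lattice point. Scaled by [N],
    these are the only exponents divisible by [N] that can occur in [W^N]. *)
Lemma triangle_points (a b : int) : a + b <= 1 -> b - 2 * a <= 1 -> a - 2 * b <= 1 ->
  [|| (a == 0) && (b == 0), (a == 1) && (b == 0), (a == 0) && (b == 1)
    | (a == -1) && (b == -1)].
Proof. lia. Qed.

(** A vertex is reached only by choosing the same term of [W] in every factor; the other two terms
    of [coef_WM] come from outside the polygon. *)
Lemma coef_WX_x l (c : int) :
  (W k ^+ l) ((c, l%:Z, 0) : heis) = if c == 0 then 1 else 0.
Proof.
elim: l => [|l IH]; first by rewrite expr0 conv_coef1 !xpair_eqE !eqxx !andbT.
rewrite exprS coef_WM (_ : l.+1%:Z - 1 = l); last by lia.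
by rewrite IH !coef_WX_out ?addr0 ?subr0//; lia.
Qed.

Lemma coef_WX_y l (c : int) :
  (W k ^+ l) ((c, 0, l%:Z) : heis) = if c == 0 then 1 else 0.
Proof.
elim: l => [|l IH]; first by rewrite expr0 conv_coef1 !xpair_eqE !eqxx !andbT.
rewrite exprS coef_WM (_ : l.+1%:Z - 1 = l); last by lia.
by rewrite subr0 IH !coef_WX_out ?add0r ?subr0//; lia.
Qed.

(** Same argument at the third vertex; moving [y^-1] past [x^-1] contributes
    [q^(0 + 1 + ... + (l - 1))]. *)
Lemma coef_WX_xy l (c : int) :
  (W k ^+ l) ((c, - l%:Z, - l%:Z) : heis)
  = if c == 'C(l, 2)%:Z then (-1) ^+ l else 0.
Proof.
elim: l c => [|l IH] c.
  by rewrite oppr0 expr0 conv_coef1 !xpair_eqE !eqxx !andbT.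
rewrite exprS coef_WM (_ : - l.+1%:Z + 1 = - l%:Z); last by lia.
rewrite (_ : c + _ + 1 = c - l%:Z); last by lia.
rewrite IH !coef_WX_out ?add0r; [|lia|lia].
rewrite subr_eq -PoszD addnC binS bin1 addnC; case: ifP; rewrite ?oppr0//.
by rewrite exprS mulN1r.
Qed.

End PowersOfW.

(** * Traces of the powers of [rho(W)] *)

Section Det.
Variables (k : fieldType) (n : nat).
Hypothesis chark : [pchar k] =i pred0.
Local Notation N := n.+1.
Local Notation Kz := (Kzeta k n).
Local Notation Kx := (Kxe k n).
Local Notation z := (zeta k n).

Definition WN : Kx := mon N%:Z 0 1 + mon 0 N%:Z 1 - mon (- N%:Z) (- N%:Z) 1.

Definition coef00 (u : Kx) : Kz := u ((0, 0) : int * int).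

Lemma coef00_is_additive : zmod_morphism coef00.
Proof. by move=> u v; rewrite /coef00 conv_coefB. Qed.

HB.instance Definition _ :=
  GRing.isZmodMorphism.Build Kx Kz coef00 coef00_is_additive.

Lemma coef00_scalC c : coef00 (scalC c) = c.
Proof. by rewrite /coef00 -mon00 monE !eqxx. Qed.

Lemma coef00_mulC u c : coef00 (u * scalC c) = coef00 u * c.
Proof.
rewrite /coef00 conv_coefM.
rewrite -(fsum_widen (P := [set ((0, 0) : int * int, (0, 0) : int * int)])) //=.
- by rewrite fsbig_set1 -mon00 monE !eqxx.
- by move=> _ ->.
move=> [[i j] [i' j']] /= ij nij; rewrite -mon00 monE.
case: ifP => [/andP[/eqP i0 /eqP j0]|_]; last by rewrite mulr0.
case: nij; move: ij; rewrite i0 j0.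
change (((i + 0, j + 0) : int * int) = (0, 0) ->
  (i, j, (0, 0)) = (0, 0, (0, 0)) :> (int * int) * (int * int)).
by rewrite !addr0 => -[-> ->].
Qed.

Lemma coef00_WN : coef00 WN = 0.
Proof.
rewrite /WN raddfB raddfD /= /coef00 !monE.
by rewrite /= addr0 subr0.
Qed.

(** [trace_rho] keeps only exponents divisible by [N]. In [l] times the triangle these are the
    origin alone for [l < N], and also the three vertices for [l = N], whose coefficients 1, 1, -1
    form [WN]. *)
Lemma trace_WX l : (0 < l <= N)%N ->
  \tr (rho n (W k) ^+ l) = scalC (modPhi n (Coeff 0 0 (W k ^+ l)) *+ N)
    + (if l == N then WN *+ N else 0).
Proof.
move=> /andP[l0 lN]; rewrite -rmorphXn; apply/convP => -[i j].
rewrite conv_coefD trace_rho// -mon00 monE.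
have [/= Nij|Nij] := boolP ((N %| i)%Z && (N %| j)%Z); last first.
  rewrite [in X in X + _]ifN; last first.
    by apply: contraNN Nij => /andP[/eqP -> /eqP ->]; rewrite !dvdz0.
  rewrite add0r; case: eqP => _ //.
  rewrite conv_coefMn /WN conv_coefB conv_coefD !monE.
  have nE (i' j' : int) : (N %| i')%Z -> (N %| j')%Z -> (i == i') && (j == j') = false.
    move=> Ni Nj; apply/negP => /andP[/eqP ii /eqP jj].
    by move: Nij; rewrite ii jj Ni Nj.
  by rewrite !nE ?rpredN ?dvdz0 ?dvdzz// addr0 subrr mul0rn.
have [/dvdzP[a ia] /dvdzP[b jb]] := andP Nij.
have [ij0|ij0] := boolP ((i == 0) && (j == 0)).
  have [/eqP -> /eqP ->] := andP ij0.
  case: eqP => _; last by rewrite addr0.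
  by rewrite conv_coefMn -/(coef00 WN) coef00_WN mul0rn addr0.
rewrite add0r; have [lE|lE] := eqVneq l N; last first.
  rewrite (_ : Coeff _ _ _ = 0) ?raddf0 ?mul0rn//; apply/convP => c; rewrite CoeffE.
  apply: coef_WX_out.
  have ab0 : (a != 0) || (b != 0).
    rewrite -negb_and; apply: contraNN ij0 => /andP[/eqP a0 /eqP b0].
    by rewrite ia jb a0 b0 !mul0r.
  have lN' : l%:Z < N%:Z by move: lE lN; lia.
  (* The forms [a + b], [b - 2a], [a - 2b] add up to 0, so at a nonzero [(a, b)] one of them is at
     least 1; multiplied by [N > l] it exceeds [l]. *)
  have pN (f : int) : 0 < f -> l%:Z < f * N by nia.
  have [/pN|] := ltP 0 (a + b); first by rewrite ia jb; lia.
  have [/pN|] := ltP 0 (b - 2 * a); first by rewrite ia jb; lia.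
  have [/pN|] := ltP 0 (a - 2 * b); first by rewrite ia jb; lia.
  by move: ab0; lia.
rewrite conv_coefMn; congr (_ *+ _).
rewrite lE /WN conv_coefB conv_coefD !monE.
have [/andP[/eqP iN /eqP j0]|ni1] := boolP ((i == N) && (j == 0)).
  rewrite iN j0 (_ : Coeff _ _ _ = convU (finite_ideal Zm) 0%Z 1).
    by rewrite modPhiU expr0z rmorph1 ?eqxx /= addr0 subr0 mulr1.
  by apply/convP => c; rewrite CoeffE coef_WX_x convUE.
have [/andP[/eqP iN /eqP j0]|ni2] := boolP ((i == 0) && (j == N)).
  rewrite iN j0 (_ : Coeff _ _ _ = convU (finite_ideal Zm) 0%Z 1).
    by rewrite modPhiU expr0z rmorph1 ?eqxx /= add0r subr0 mulr1.
  by apply/convP => c; rewrite CoeffE coef_WX_y convUE.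
have [/andP[/eqP iN /eqP j0]|ni3] := boolP ((i == - N%:Z) && (j == - N%:Z)).
  rewrite iN j0 (_ : Coeff _ _ _ = convU (finite_ideal Zm) 'C(N, 2)%:Z ((-1) ^+ N)).
    (* The signs [(-1)^N] of the coefficient and [(-1)^n] from [zeta_binom] multiply to -1. *)
    rewrite modPhiU rmorphXn rmorphN1 -[z ^ _]/(z ^+ 'C(N, 2)) zeta_binom//.
    by rewrite -exprD addSn exprS -signr_odd addnn odd_double mulr1 ?eqxx /= add0r sub0r.
  by apply/convP => c; rewrite CoeffE coef_WX_xy convUE.
rewrite addr0 subrr (_ : Coeff _ _ _ = 0) ?raddf0//; apply/convP => c; rewrite CoeffE.
apply: coef_WX_out.
have pN (f : int) : 1 < f -> N%:Z < f * N by nia.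
have [/pN|] := ltP 1 (a + b); first by rewrite ia jb; lia.
have [/pN|] := ltP 1 (b - 2 * a); first by rewrite ia jb; lia.
have [/pN|] := ltP 1 (a - 2 * b); first by rewrite ia jb; lia.
move=> f3 f2 f1; have := triangle_points f1 f2 f3.
by case/or4P => /andP[/eqP a0 /eqP b0]; move: ij0 ni1 ni2 ni3;
  rewrite ia jb a0 b0 ?mul0r ?mul1r ?mulN1r ?eqxx.
Qed.

End Det.

(** * The shape of the determinant and its comparison with [G_q^N] *)

Section Determinant.
Variables (k : fieldType) (n : nat).
Hypothesis chark : [pchar k] =i pred0.
Local Notation N := n.+1.
Local Notation Kz := (Kzeta k n).
Local Notation Kx := (Kxe k n).
Local Notation iota := (@qpolyC k (Phi k n)).
Local Notation coef00 := (@coef00 k n).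
Local Notation scal := (@scalC k n).

(* The commutative specialisation [q = 1], [x = Xi ^+ N], [y = Eta ^+ N]. *)
Definition psi_gen (g : heis) (r : k) : Kx :=
  mon (N%:Z * g.1.2) (N%:Z * g.2) (iota r).

Lemma psi_gen_is_additive g : zmod_morphism (psi_gen g).
Proof. by move=> r s; rewrite /psi_gen !raddfB. Qed.

Definition psi : qtorus k -> Kx := alg_lift psi_gen.

Lemma psi_is_additive : zmod_morphism psi.
Proof. exact: (alg_lift_is_additive psi_gen_is_additive). Qed.

Lemma psi_is_multiplicative : monoid_morphism psi.
Proof.
apply: (alg_lift_is_multiplicative psi_gen_is_additive).
  by rewrite /psi_gen /= !mulr0 mon00 !rmorph1.
move=> [[c i] j] [[c' i'] j'] r s.
change (psi_gen (c, i, j) r * psi_gen (c', i', j') s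
        = psi_gen (c + c' + j * i', i + i', j + j') (r * s)).
by rewrite /psi_gen /= monM rmorphM !mulrDr.
Qed.

HB.instance Definition _ :=
  GRing.isZmodMorphism.Build (qtorus k) Kx psi psi_is_additive.
HB.instance Definition _ :=
  GRing.isMonoidMorphism.Build (qtorus k) Kx psi psi_is_multiplicative.

Lemma psiU g r : psi (convU (finite_ideal heis) g r) = psi_gen g r.
Proof. exact: (alg_liftU psi_gen_is_additive). Qed.

Lemma psi_W : psi (W k) = WN k n.
Proof.
rewrite W_qmon rmorphB rmorphD /= /qmon !psiU /psi_gen /=.
by rewrite !mulr0 !mulr1 !mulrN1 !rmorph1.
Qed.

(** Scaling exponents by [N > 0] preserves constant terms; with [psi_W], the constant term of
    [WN ^+ m] is therefore [c_m(1)]. *)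
Lemma coef00_psi a : coef00 (psi a) = iota (eval1 (Coeff 0 0 a)).
Proof.
move: a; apply: conv_fin_ext => [a b|a b|[[c i] j] r].
- by rewrite !raddfB.
- by rewrite !raddfB.
have N0 (l : int) : (0 == N%:Z * l) = (l == 0) by rewrite eq_sym mulf_eq0.
rewrite psiU /psi_gen /coef00 monE /= !N0.
have -> : Coeff 0 0 (convU (finite_ideal heis) (c, i, j) r) =
    if (i == 0) && (j == 0) then convU (finite_ideal Zm) c r else 0.
  apply/convP => c'; rewrite CoeffE convUE -[_ == _]/((c' == c) && (0 == i) && (0 == j)).
  rewrite -andbA ![0 == _]eq_sym; case: (_ && (j == 0)) => /=; last by rewrite andbF.
  by rewrite andbT convUE.
by case: ifP => _; rewrite ?eval1U ?raddf0.
Qed.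

Let A : 'M[Kx]_N := rho n (W k).
Let d : lser Kx := \det (char_ser_mx A).

Lemma rho_ser_D : rho_ser n (D k) = char_ser_mx A.
Proof.
apply/matrixP => i j; rewrite !mxE D_W; apply/convP => m.
rewrite map_convE; last by rewrite raddf0 mxE.
rewrite !conv_coefB /lambda /lserC !convUE conv_coefMn convUE raddfB /= 2!mxE.
congr (_ + _).
  case: ifP => _; last by rewrite raddf0 mxE mul0rn.
  by rewrite rmorph1 mxE.
by case: ifP => _; rewrite // raddf0 mxE.
Qed.

Lemma Kx_natr_unit m : (0 < m)%N -> m%:R \is a @GRing.unit Kx.
Proof. by move=> m0; apply: conv_natr_unit; exact: iota_natr_unit. Qed.

Definition is_scal (u : Kx) := scal (coef00 u) = u.

Lemma is_scalC c : is_scal (scal c).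
Proof. by rewrite /is_scal coef00_scalC. Qed.

Lemma is_scalD u v : is_scal u -> is_scal v -> is_scal (u + v).
Proof. by move=> su sv; rewrite /is_scal !raddfD /= su sv. Qed.

Lemma is_scalM u v : is_scal u -> is_scal v -> is_scal (u * v).
Proof. by move=> <- <-; rewrite -rmorphM; exact: is_scalC. Qed.

Lemma is_scal_sum m (F : 'I_m -> Kx) :
  (forall i, is_scal (F i)) -> is_scal (\sum_i F i).
Proof.
move=> sF; elim/big_ind: _ => //; last exact: is_scalD.
by rewrite -(rmorph0 scal); exact: is_scalC.
Qed.

Lemma is_scal_divn u m : (0 < m)%N -> is_scal (u *~ (- m%:Z)) -> is_scal u.
Proof.
move=> m0; rewrite /is_scal !raddfMz /= !mulrNz => /oppr_inj.
by apply: natr_unit_inj; exact: Kx_natr_unit.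
Qed.

(** Induction through Newton's identities, which here involve only the traces of [A ^+ l] with
    [0 < l < N], all free of [xi] and [eta]. *)
Lemma is_scal_char (j : nat) : (j < N)%N -> is_scal (d (N%:Z - j%:Z : int)).
Proof.
elim/ltn_ind: j => -[_ _|j IH jN].
  rewrite subr0 (ser_monic_char A).2 -(rmorph1 scal); exact: is_scalC.
apply: (@is_scal_divn _ j.+1) => //; rewrite char_ser_newton.
apply: is_scal_sum => i; apply: is_scalM.
  by apply: IH => //; apply: ltn_trans jN.
rewrite trace_WX//; last by have := ltn_ord i; lia.
rewrite ifN ?addr0; last by have := ltn_ord i; lia.
exact: is_scalC.
Qed.

(** In the last Newton identity [\tr (A ^+ N)] brings the extra term [N W_N], which after division
    by [- N] becomes [- W_N]. *)
Lemma is_scal_char0 : is_scal (d (0 : int) + WN k n).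
Proof.
apply: (@is_scal_divn _ N) => //.
have := char_ser_newton A N; rewrite subrr -/d mulrzDl => ->.
rewrite big_ord_recl /= subr0 (ser_monic_char A).2 mul1r trace_WX//; last by rewrite leqnn.
rewrite eqxx mulrNz -pmulrn [X in is_scal (X - _)]addrAC addrK.
apply: is_scalD; first exact: is_scalC.
apply: is_scal_sum => i; apply: is_scalM.
  by apply: is_scal_char; rewrite /= /bump; have := ltn_ord i; lia.
rewrite trace_WX//; last by rewrite /= /bump; have := ltn_ord i; lia.
rewrite ifN ?addr0; last by rewrite /= /bump; have := ltn_ord i; lia.
exact: is_scalC.
Qed.

Definition Pser : lser Kz := map_conv coef00 d.

Lemma det_Pser : d = map_conv scal Pser - lserC (WN k n).
Proof.
apply/convP => m; rewrite conv_coefB !map_convE ?raddf0// /lserC convUE.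
have [->|m0] := eqVneq (m : int) 0.
  rewrite -[X in X - _]/(scal (coef00 (d (0 : int)))).
  by have := is_scal_char0; rewrite /is_scal raddfD /= coef00_WN addr0 => ->; rewrite addrK.
rewrite subr0; have [mN|Nm] := ltP N%:Z (m : int).
  by rewrite (ser_monic_char A).1// !raddf0.
have [mneg|mpos] := ltP (m : int) 0.
  by rewrite /d coef_char_ser_neg// !raddf0.
have -> : m = (N%:Z - (absz (N%:Z - (m : int))%R)%:Z : int) :> Zm by rewrite /Zm; lia.
rewrite is_scal_char//; move: m0 mpos Nm; move: (m : int) => M; lia.
Qed.

Lemma ser_monic_Pser : ser_monic Pser N%:Z.
Proof.
have [d1 d2] := ser_monic_char A; split; first exact: dle_map.
by rewrite map_convE ?raddf0// d2 -(rmorph1 scal) /= coef00_scalC.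
Qed.

Definition geom_WN : lser Kx := inv_series (fun m => WN k n ^+ m).

Lemma geom_WNE :
  (lambda - lserC (WN k n)) * (convU ubounded_ideal (-1 : int) 1 * geom_WN) = 1.
Proof.
rewrite mulrBl mulrA convUM mulr1 -[convU _ _ 1]/(1 : lser Kx) mul1r.
rewrite mulrA convUM mulr1 [(_ * _)%g](_ : _ = (-1 : int) :> Zm)//; apply/convP => m.
rewrite conv_coefB coefUM ser_coef1.
have [m0|m0|->] := ltrgtP (m : int) 0.
- have [j ->] : exists j : nat, m = (- j.+1%:Z : int) :> Zm.
    by exists (absz (m : int)).-1; move: m0; rewrite /Zm; lia.
  rewrite (_ : - j.+1%:Z - -1 = - j%:Z :> int); last by lia.
  by rewrite /geom_WN !coef_inv_series exprS subrr.
- rewrite !(dle_inv_series (fun m => WN k n ^+ m)) ?mulr0 ?subrr//.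
  by move: m0; move: (m : int) => M; lia.
by rewrite [geom_WN _](coef_inv_series _ 0) /geom_WN inv_seriesE /= mulr0 subr0 expr0.
Qed.

Definition C1 : lser Kz := map_conv iota (map_conv (@eval1 k) (Cser k)).
Definition Cz : lser Kz := map_conv (@modPhi k n) (Cser k).

(** The constant terms in [xi] and [eta] of the logarithmic derivative of the determinant, computed
    in two ways; both sides are multiplied by [P]. *)
Lemma Pser_C1 : lcomp C1 Pser * ser_euler Pser = Pser * (Cz *+ N).
Proof.
have monP := ser_monic_Pser; have monPh := ser_monic_map (@scalC k n) monP.
pose Rr : lser Kx := convU ubounded_ideal (-1 : int) 1 * geom_WN.
(* The inverse of the determinant [P - W_N]: [P] is substituted for [lambda] in the expansion of
   [(lambda - W_N)^-1]. *)
pose sR := lcomp Rr (map_conv scal Pser).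
have dsR : d * sR = 1.
  rewrite -(lcomp1 monPh) -geom_WNE (lcompM monPh) det_Pser; congr (_ * _).
  by rewrite (lcomp_is_additive monPh) (lcomp_lambda monPh) (lcompC monPh).
(* [W_N] is constant in [lambda], so this factor is free of [xi] and [eta] and constant terms can be
   taken factorwise. *)
have ed : ser_euler d = map_conv scal (ser_euler Pser).
  by rewrite {1}det_Pser raddfB /= ser_eulerU mulr0z raddf0 subr0 map_euler.
have sRd : sR * map_conv scal (ser_euler Pser) = trace_ser A.
  by rewrite -ed euler_char_ser mulrA [sR * _]mulrC -/d dsR mul1r.
have := congr1 (map_conv coef00) sRd.
rewrite (map_convM_scal (psi := idfun)); last by move=> x y; exact: coef00_mulC.
rewrite (map_lcomp_scal (psi := idfun) _ _ monP); last by move=> x y; exact: coef00_mulC.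
rewrite !map_conv_id => eq1.
(* For every [m], beyond [N] as well, the constant term of [\tr (A ^+ m)] is [N c_m(q)]. *)
have -> : Cz *+ N = map_conv coef00 (trace_ser A).
  apply/convP => m; rewrite conv_coefMn !map_convE ?raddf0// /Cser /trace_ser !inv_seriesE.
  case: ifP => _; last by rewrite !raddf0 mul0rn.
  by rewrite -rmorphXn /coef00 trace_rho.
rewrite -eq1 mulrA; congr (_ * _).
(* The factor [P] enters the substitution as [lambda] and cancels the [lambda^-1] in [Rr]. *)
rewrite -[X in X * _](lcomp_lambda monP) -(lcompM monP); congr lcomp.
rewrite /C1 /Cser !map_inv_series.
have -> : lambda * map_conv coef00 Rr = map_conv coef00 (lambda * Rr).
  by apply/convP => m; rewrite coef_lambdaM !map_convE ?raddf0// coef_lambdaM.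
rewrite /Rr mulrA convUM mulr1 -[convU _ _ 1]/(1 : lser Kx) mul1r /geom_WN.
rewrite map_inv_series; congr inv_series; apply/funext => m /=.
by rewrite -psi_W -rmorphXn coef00_psi.
Qed.

Let Gz := map_conv (@modPhi k n) (Gq k).
Let G1z := map_conv iota (G1 k).

Lemma ser_monic_G1 : ser_monic (G1 k) 1.
Proof. exact/ser_monic_map/(ser_monic_Gq chark). Qed.

(** Both sides are monic of degree [N] and solve [delta f = f h] with [h = Cz *+ N], so
    [euler_unique] applies. *)
Lemma Gq_power : Gz ^+ N = lcomp G1z Pser.
Proof.
have monP := ser_monic_Pser; have monG := ser_monic_Gq chark.
have monG1 : ser_monic G1z 1 by exact/ser_monic_map/ser_monic_G1.
have Cz0 : (Cz *+ N) (0 : int) = N%:R.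
  rewrite conv_coefMn map_convE ?raddf0// /Cser inv_seriesE lexx expr0.
  by rewrite Coeff1 rmorph1.
have dC : dle (Cz *+ N) 0.
  by move=> m m0; rewrite conv_coefMn (dle_map (@modPhi k n) (dle_inv_series _)) ?mul0rn.
apply: (euler_unique _ dC Cz0).
- move=> m x m0 xm; apply: (@natr_unit_torsion Kz (absz m)).
    by apply: iota_natr_unit => //; rewrite absz_gt0.
  case: m m0 xm => m _; first by [].
  by rewrite NegzE mulrNz => /eqP; rewrite oppr_eq0 => /eqP.
- rewrite -[N%:Z]mul1r; apply: ser_monicX; exact: ser_monic_map.
- rewrite -[N%:Z]mul1r; exact: ser_monic_lcomp.
- have eGz : ser_euler Gz = Gz * Cz by rewrite /Gz -map_euler (euler_Gq chark) rmorphM.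
  by rewrite ser_eulerX eGz mulrA -exprSr mulrnAr.
(* The chain rule for [G_1(P)] carries the unit factor [P]; [Pser_C1] then replaces [C1(P) delta P]
   by [N P Cz]. *)
apply: (mulrI (ser_monic_unit monP)); rewrite (euler_lcomp monP).
have -> : ser_euler G1z = G1z * C1.
  by rewrite /G1z /G1 -!map_euler (euler_Gq chark) !rmorphM.
by rewrite (lcompM monP) -mulrA Pser_C1 mulrCA.
Qed.

(** [F(G_q^N) = F(G_1(P)) = P] by associativity of substitution; reduction modulo [Phi_N] is done
    first, as [Gq_power] is an identity over [Kzeta]. *)
Lemma Finv_Gq :
  modPhi_ser n (lcomp (map_conv (@laurentC k) (Finv k)) (Gq k ^+ N))
  = map_conv scal Pser.
Proof.
have monG := ser_monic_Gq chark; have monP := ser_monic_Pser.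
have monGN : ser_monic (Gq k ^+ N) N%:Z by rewrite -[N%:Z]mul1r; exact: ser_monicX.
have -> f : modPhi_ser n f = map_conv scal (map_conv (@modPhi k n) f).
  by apply/convP => m; rewrite /modPhi_ser !map_convE ?raddf0.
congr map_conv; rewrite (map_lcomp _ _ monGN) rmorphXn /= Gq_power.
have -> : map_conv (@modPhi k n) (map_conv (@laurentC k) (Finv k))
        = map_conv iota (Finv k).
  apply/convP => m; rewrite !map_convE ?raddf0// /laurentC modPhiU.
  by rewrite expr0z mulr1.
rewrite -(@lcomp_lcomp _ _ _ monP _ _ 0); last exact/ser_monic_map/ser_monic_G1.
rewrite -(map_lcomp _ (N := 0)); last exact: ser_monic_G1.
have [_ _ ->] := compinvP ser_monic_G1.
by rewrite map_convU /= [iota 1]rmorph1 (lcomp_lambda monP).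
Qed.

Lemma lserC_WN :
  lserC (- Xi k n ^+ N - Eta k n ^+ N + Xi k n ^- N * Eta k n ^- N)
  = - lserC (WN k n).
Proof.
rewrite -rmorphN; congr lserC.
have XiE (l : int) : Xi k n ^ l = mon l 0 1.
  by rewrite (_ : Xi k n = mon 1 0 1)// mon_exprz mul1r mul0r.
have EtaE (l : int) : Eta k n ^ l = mon 0 l 1.
  by rewrite (_ : Eta k n = mon 0 1 1)// mon_exprz mul1r mul0r.
rewrite !exprnN -[Xi k n ^+ N]/(Xi k n ^ N%:Z) -[Eta k n ^+ N]/(Eta k n ^ N%:Z).
rewrite !XiE !EtaE monM addr0 add0r mulr1 /WN opprB opprD.
by rewrite addrC.
Qed.

End Determinant.

Theorem theorem6p1 (k : fieldType) (chark : [pchar k] =i pred0) (n : nat) :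
  \det (rho_ser n (D k)) =
    lserC (- Xi k n ^+ n.+1 - Eta k n ^+ n.+1 + Xi k n ^- n.+1 * Eta k n ^- n.+1)
    + modPhi_ser n (lcomp (map_conv (@laurentC k) (Finv k)) (Gq k ^+ n.+1)).
Proof.
by rewrite rho_ser_D det_Pser// Finv_Gq// lserC_WN addrC.
Qed.
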